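(* Let $\Phi=(A;\{E_i\}_{i=0}^d;A^*;\{E^*_i\}_{i=0}^d)$ be a tridiagonal system on $V$ with diameter $d\geq 1$ that has $q$-Serre type, and regard $V$ as a $U^+_q$-module on which $W_0$ acts as $A$ and $W_1$ acts as $A^*$. Let $\{\mathcal V_i\}_{i=0}^d$ be one of the six decompositions $[0,D]$, $[0^*,D^*]$, $[0^*,0]$, $[0^*,D]$, $[D^*,0]$, $[D^*,D]$ of $V$ (with $\mathcal V_{-1}=\mathcal V_{d+1}=0$). Then for all $k\in\mathbb N$ and $0\leq i\leq d$: (a) for $[0,D]$: $W_{-k}\mathcal V_i\subseteq \mathcal V_i$ and $W_{k+1}\mathcal V_i\subseteq \mathcal V_{i-1}+\mathcal V_i+\mathcal V_{i+1}$; (b) for $[0^*,D^*]$: $W_{-k}\mathcal V_i\subseteq \mathcal V_{i-1}+\mathcal V_i+\mathcal V_{i+1}$ and $W_{k+1}\mathcal V_i\subseteq \mathcal V_i$; (c) for each of $[0^*,0]$, $[0^*,D]$, $[D^*,0]$, $[D^*,D]$: $W_{-k}\mathcal V_i\subseteq \mathcal V_i+\mathcal V_{i+1}$ and $W_{k+1}\mathcal V_i\subseteq \mathcal V_{i-1}+\mathcal V_i$.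
   Context: $\mathbb F$ is a field, $V$ a nonzero finite-dimensional $\mathbb F$-vector space. A tridiagonal (TD) pair on $V$ is an ordered pair $A,A^*\in\mathrm{End}(V)$ such that: (i) each of $A,A^*$ is diagonalizable; (ii) there is an ordering $\{V_i\}_{i=0}^d$ of the eigenspaces of $A$ with $A^*V_i\subseteq V_{i-1}+V_i+V_{i+1}$ ($V_{-1}=V_{d+1}=0$); (iii) there is an ordering $\{V^*_i\}_{i=0}^\delta$ of the eigenspaces of $A^*$ with $AV^*_i\subseteq V^*_{i-1}+V^*_i+V^*_{i+1}$; (iv) there is no subspace $W\neq 0,V$ with $AW\subseteq W$, $A^*W\subseteq W$. Such orderings are called standard. A TD system on $V$ is a sequence $(A;\{E_i\}_{i=0}^d;A^*;\{E^*_i\}_{i=0}^\delta)$ where $A,A^*$ is a TD pair, $\{E_i\}$ are the primitive idempotents of $A$ in a standard ordering and $\{E^*_i\}$ those of $A^*$ in a standard ordering; one always has $d=\delta$ (the diameter). Let $\theta_i$ (resp. $\theta^*_i$) be the eigenvalue of $A$ for $E_i$ (resp. of $A^*$ for $E^*_i$). Fix a nonzero $q$ in the algebraic closure of $\mathbb F$, not a root of unity, with $b=q^2\in\mathbb F$. $\Phi$ has $q$-Serre type if $\theta_i=b\theta_{i-1}$ and $\theta^*_i=b^{-1}\theta^*_{i-1}$ for $1\leq i\leq d$. $U^+_q$ is the $\mathbb F$-algebra with generators $W_0,W_1$ and relations $[W_0,[W_0,[W_0,W_1]_b]_{b^{-1}}]=0$, $[W_1,[W_1,[W_1,W_0]_b]_{b^{-1}}]=0$,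 where $[X,Y]=XY-YX$ and $[X,Y]_b=bXY-YX$. When $\Phi$ has $q$-Serre type, $A,A^*$ satisfy these relations, so $V$ is a $U^+_q$-module with $W_0\mapsto A$, $W_1\mapsto A^*$. The alternating elements $W_{-k},W_{k+1},G_{k+1},\tilde G_{k+1}$ ($k\in\mathbb N$) of $U^+_q$ are defined recursively, in the order $W_0,W_1,G_1,\tilde G_1,W_{-1},W_2,G_2,\tilde G_2,W_{-2},W_3,\dots$, with $G_0=\tilde G_0=1$, by: for $n\geq1$, $G_n=\frac{\sum_{k=0}^{n-1}W_{-k}W_{n-k}b^{-k}-\sum_{k=1}^{n-1}G_k\tilde G_{n-k}b^{-k}}{1+b^{-n}}+\frac{[W_n,W_0]}{(1+b^{-n})(1-b^{-1})}$, $\tilde G_n=G_n+\frac{[W_0,W_n]}{1-b^{-1}}$, $W_{-n}=\frac{[W_0,G_n]_b}{b-1}$, $W_{n+1}=\frac{[G_n,W_1]_b}{b-1}$. The six decompositions of $V$ (each a sequence $\{\mathcal V_i\}_{i=0}^d$ of subspaces with direct sum $V$) have $i$-th components: $[0,D]$: $E_iV$; $[0^*,D^*]$: $E^*_iV$; $[0^*,0]$: $(E^*_0V+\cdots+E^*_iV)\cap(E_0V+\cdots+E_{d-i}V)$; $[0^*,D]$: $(E^*_0V+\cdots+E^*_iV)\cap(E_iV+\cdots+E_dV)$; $[D^*,0]$: $(E^*_{d-i}V+\cdots+E^*_dV)\cap(E_0V+\cdots+E_{d-i}V)$; $[D^*,D]$: $(E^*_{d-i}V+\cdots+E^*_dV)\cap(E_iV+\cdots+E_dV)$.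 *)

(* Defs.v *)
From HB Require Import structures.
From mathcomp Require Import all_boot all_order all_algebra.
From mathcomp Require Import boolp ring zify.

Set Implicit Arguments.
Unset Strict Implicit.
Unset Printing Implicit Defensive.

Import GRing.Theory passmx.
Local Open Scope quotient_scope.
Local Open Scope ring_scope.

Section TridiagonalSystems.
Variables (F : fieldType) (V : vectType F).
Implicit Types (X Y : 'End(V)) (d : nat).

(* [vat U k] is the [k]-th component of [{U_i}_{i=0}^d] for an arbitrary      *)
(* integer [k]; it is 0 for [k] outside [0, d], so U_{-1} = U_{d+1} = 0.      *)
Definition vat d (U : 'I_d.+1 -> {vspace V}) (k : int) : {vspace V} :=
  (\sum_(j < d.+1 | j%:Z == k) U j)%VS.

Definition diagonalizable_end X : Prop :=
  exists s : seq F, (\sum_(a <- s) leigenspace X a)%VS = fullv.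

Definition eigenspace_ordering X d (U : 'I_d.+1 -> {vspace V}) : Prop :=
  injective U /\
  forall W : {vspace V},
    (exists i, W = U i) <-> (exists2 a, leigenvalue X a & W = leigenspace X a).

Definition standard_ordering X Y d (U : 'I_d.+1 -> {vspace V}) : Prop :=
  eigenspace_ordering X U /\
  forall i : 'I_d.+1,
    (Y @: U i <= vat U (i%:Z - 1) + U i + vat U (i%:Z + 1))%VS.

Definition TD_pair X Y : Prop :=
  [/\ diagonalizable_end X /\ diagonalizable_end Y,
      exists d (U : 'I_d.+1 -> {vspace V}), standard_ordering X Y U,
      exists delta (Us : 'I_delta.+1 -> {vspace V}), standard_ordering Y X Us &
      forall W : {vspace V},
        (X @: W <= W)%VS -> (Y @: W <= W)%VS -> W = 0%VS \/ W = fullv].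

(* [E i] is the projection onto [U i] along the sum of the other [U j].       *)
Definition primitive_idempotents d (U : 'I_d.+1 -> {vspace V})
    (E : 'I_d.+1 -> 'End(V)) : Prop :=
  forall i j v, v \in U j -> E i v = if i == j then v else 0.

Definition TD_system d delta (A : 'End(V)) (E : 'I_d.+1 -> 'End(V))
    (As : 'End(V)) (Es : 'I_delta.+1 -> 'End(V)) : Prop :=
  [/\ TD_pair A As,
      exists2 U, standard_ordering A As U & primitive_idempotents U E &
      exists2 Us, standard_ordering As A Us & primitive_idempotents Us Es].

Definition eigenvalue_sequence X d (E : 'I_d.+1 -> 'End(V))
    (th : 'I_d.+1 -> F) : Prop :=
  forall i, limg (E i) = leigenspace X (th i).

Definition q_Serre_type (b : F) d (A : 'End(V)) (E : 'I_d.+1 -> 'End(V))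
    (As : 'End(V)) (Es : 'I_d.+1 -> 'End(V)) : Prop :=
  exists th ths : 'I_d.+1 -> F,
    [/\ eigenvalue_sequence A E th, eigenvalue_sequence As Es ths &
        forall i j : 'I_d.+1, i = j.+1 :> nat ->
          th i = b * th j /\ ths i = b^-1 * ths j].

(* The names follow [0,D], [0*,D*], [0*,0], [0*,D], [D*,0], [D*,D], with "s"  *)
(* for the star.                                                              *)
Section Decompositions.
Variables (d : nat) (E Es : 'I_d.+1 -> 'End(V)).
Implicit Type i : 'I_d.+1.

Definition dec_0_D i : {vspace V} := limg (E i).

Definition dec_0s_Ds i : {vspace V} := limg (Es i).

Definition dec_0s_0 i : {vspace V} :=
  ((\sum_(j < d.+1 | (j <= i)%N) limg (Es j)) :&:
   (\sum_(j < d.+1 | (j <= d - i)%N) limg (E j)))%VS.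

Definition dec_0s_D i : {vspace V} :=
  ((\sum_(j < d.+1 | (j <= i)%N) limg (Es j)) :&:
   (\sum_(j < d.+1 | (i <= j)%N) limg (E j)))%VS.

Definition dec_Ds_0 i : {vspace V} :=
  ((\sum_(j < d.+1 | (d - i <= j)%N) limg (Es j)) :&:
   (\sum_(j < d.+1 | (j <= d - i)%N) limg (E j)))%VS.

Definition dec_Ds_D i : {vspace V} :=
  ((\sum_(j < d.+1 | (d - i <= j)%N) limg (Es j)) :&:
   (\sum_(j < d.+1 | (i <= j)%N) limg (E j)))%VS.

End Decompositions.

End TridiagonalSystems.

Definition comm (F : fieldType) (R : algType F) (x y : R) : R := x * y - y * x.
Definition qcomm (F : fieldType) (R : algType F) (c : F) (x y : R) : R :=
  c *: (x * y) - y * x.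

(* Formal expressions in the two generators; U_q^+ is their quotient by the   *)
(* least congruence containing the axioms of unital associative algebras and  *)
(* the two defining relations.                                                *)
Inductive Uq_term (F : Type) : Type :=
| TW0 | TW1 | TZero | TOne
| TOpp of Uq_term F
| TAdd of Uq_term F & Uq_term F
| TMul of Uq_term F & Uq_term F
| TScale of F & Uq_term F.

Arguments TW0 {F}.
Arguments TW1 {F}.
Arguments TZero {F}.
Arguments TOne {F}.

HB.instance Definition _ (F : Type) := gen_eqMixin (Uq_term F).
HB.instance Definition _ (F : Type) := gen_choiceMixin (Uq_term F).

Definition Tcomm (F : Type) (x y : Uq_term F) : Uq_term F :=
  TAdd (TMul x y) (TOpp (TMul y x)).
Definition Tqcomm (F : Type) (c : F) (x y : Uq_term F) : Uq_term F :=
  TAdd (TScale c (TMul x y)) (TOpp (TMul y x)).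

Inductive Uq_cong (F : fieldType) (b : F) : Uq_term F -> Uq_term F -> Prop :=
| cong_refl x : Uq_cong b x x
| cong_sym x y : Uq_cong b x y -> Uq_cong b y x
| cong_trans x y z : Uq_cong b x y -> Uq_cong b y z -> Uq_cong b x z
| cong_opp x y : Uq_cong b x y -> Uq_cong b (TOpp x) (TOpp y)
| cong_add x x' y y' : Uq_cong b x x' -> Uq_cong b y y' ->
    Uq_cong b (TAdd x y) (TAdd x' y')
| cong_mul x x' y y' : Uq_cong b x x' -> Uq_cong b y y' ->
    Uq_cong b (TMul x y) (TMul x' y')
| cong_scale c x y : Uq_cong b x y -> Uq_cong b (TScale c x) (TScale c y)
| cong_addA x y z : Uq_cong b (TAdd x (TAdd y z)) (TAdd (TAdd x y) z)
| cong_addC x y : Uq_cong b (TAdd x y) (TAdd y x)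
| cong_add0 x : Uq_cong b (TAdd TZero x) x
| cong_addN x : Uq_cong b (TAdd (TOpp x) x) TZero
| cong_mulA x y z : Uq_cong b (TMul x (TMul y z)) (TMul (TMul x y) z)
| cong_mul1l x : Uq_cong b (TMul TOne x) x
| cong_mul1r x : Uq_cong b (TMul x TOne) x
| cong_mulDl x y z : Uq_cong b (TMul (TAdd x y) z) (TAdd (TMul x z) (TMul y z))
| cong_mulDr x y z : Uq_cong b (TMul x (TAdd y z)) (TAdd (TMul x y) (TMul x z))
| cong_scaleA c e x : Uq_cong b (TScale c (TScale e x)) (TScale (c * e) x)
| cong_scale1 x : Uq_cong b (TScale 1 x) x
| cong_scaleDr c x y :
    Uq_cong b (TScale c (TAdd x y)) (TAdd (TScale c x) (TScale c y))
| cong_scaleDl c e x :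
    Uq_cong b (TScale (c + e) x) (TAdd (TScale c x) (TScale e x))
| cong_scaleAl c x y : Uq_cong b (TScale c (TMul x y)) (TMul (TScale c x) y)
| cong_scaleAr c x y : Uq_cong b (TScale c (TMul x y)) (TMul x (TScale c y))
| cong_rel0 :
    Uq_cong b (Tcomm TW0 (Tqcomm b^-1 TW0 (Tqcomm b TW0 TW1))) TZero
| cong_rel1 :
    Uq_cong b (Tcomm TW1 (Tqcomm b^-1 TW1 (Tqcomm b TW1 TW0))) TZero.

Section Uq.
Variables (F : fieldType) (b : F).
Local Notation term := (Uq_term F).
Local Notation cong := (@Uq_cong F b).

Definition Uq_eqv : rel term := fun x y => `[< cong x y >].

Fact Uq_eqv_refl : reflexive Uq_eqv.
Proof. by move=> x; apply/asboolP; exact: cong_refl. Qed.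

Fact Uq_eqv_sym : symmetric Uq_eqv.
Proof. by move=> x y; apply/asboolP/asboolP; exact: cong_sym. Qed.

Fact Uq_eqv_trans : transitive Uq_eqv.
Proof.
by move=> y x z /asboolP xy /asboolP yz; apply/asboolP; exact: cong_trans yz.
Qed.

Canonical Uq_equiv := EquivRel Uq_eqv Uq_eqv_refl Uq_eqv_sym Uq_eqv_trans.

Definition Uq := {eq_quot Uq_equiv}%qT.
HB.instance Definition _ := Choice.on Uq.
HB.instance Definition _ := EqQuotient.on Uq.

Definition Uq_pi (x : term) : Uq := \pi_Uq x.
Definition Uq_W0 : Uq := Uq_pi TW0.
Definition Uq_W1 : Uq := Uq_pi TW1.

Lemma Uq_piP x y : cong x y <-> Uq_pi x = Uq_pi y.
Proof.
split; first by move=> xy; apply/eqP; rewrite /Uq_pi eqmodE; apply/asboolP.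
by move/eqP; rewrite /Uq_pi eqmodE => /asboolP.
Qed.

Lemma Uq_reprK (x : Uq) : Uq_pi (repr x) = x.
Proof. exact: reprK. Qed.

Lemma Uq_repr x : cong (repr (Uq_pi x)) x.
Proof. by apply/Uq_piP; rewrite Uq_reprK. Qed.

Definition Uq_opp (x : Uq) : Uq := Uq_pi (TOpp (repr x)).
Definition Uq_add (x y : Uq) : Uq := Uq_pi (TAdd (repr x) (repr y)).
Definition Uq_mul (x y : Uq) : Uq := Uq_pi (TMul (repr x) (repr y)).
Definition Uq_scale (c : F) (x : Uq) : Uq := Uq_pi (TScale c (repr x)).

Lemma Uq_oppE x : Uq_opp (Uq_pi x) = Uq_pi (TOpp x).
Proof. by apply/Uq_piP/cong_opp/Uq_repr. Qed.
Lemma Uq_addE x y : Uq_add (Uq_pi x) (Uq_pi y) = Uq_pi (TAdd x y).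
Proof. by apply/Uq_piP/cong_add; exact/Uq_repr. Qed.
Lemma Uq_mulE x y : Uq_mul (Uq_pi x) (Uq_pi y) = Uq_pi (TMul x y).
Proof. by apply/Uq_piP/cong_mul; exact/Uq_repr. Qed.
Lemma Uq_scaleE c x : Uq_scale c (Uq_pi x) = Uq_pi (TScale c x).
Proof. by apply/Uq_piP/cong_scale/Uq_repr. Qed.

Let UqE := (Uq_oppE, Uq_addE, Uq_mulE, Uq_scaleE).
Lemma Uq_ind (P : Uq -> Prop) : (forall x, P (Uq_pi x)) -> forall x, P x.
Proof. by move=> PH x; rewrite -(Uq_reprK x). Qed.

Fact Uq_addA : associative Uq_add.
Proof.
elim/Uq_ind=> x; elim/Uq_ind=> y; elim/Uq_ind=> z.
by rewrite !UqE; apply/Uq_piP/cong_addA.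
Qed.
Fact Uq_addC : commutative Uq_add.
Proof.
by elim/Uq_ind=> x; elim/Uq_ind=> y; rewrite !UqE; apply/Uq_piP/cong_addC.
Qed.
Fact Uq_add0 : left_id (Uq_pi TZero) Uq_add.
Proof. by elim/Uq_ind=> x; rewrite !UqE; apply/Uq_piP/cong_add0. Qed.
Fact Uq_addN : left_inverse (Uq_pi TZero) Uq_opp Uq_add.
Proof. by elim/Uq_ind=> x; rewrite !UqE; apply/Uq_piP/cong_addN. Qed.

HB.instance Definition _ :=
  GRing.isZmodule.Build Uq Uq_addA Uq_addC Uq_add0 Uq_addN.

Fact Uq_mulA : associative Uq_mul.
Proof.
elim/Uq_ind=> x; elim/Uq_ind=> y; elim/Uq_ind=> z.
by rewrite !UqE; apply/Uq_piP/cong_mulA.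
Qed.
Fact Uq_mul1l : left_id (Uq_pi TOne) Uq_mul.
Proof. by elim/Uq_ind=> x; rewrite !UqE; apply/Uq_piP/cong_mul1l. Qed.
Fact Uq_mul1r : right_id (Uq_pi TOne) Uq_mul.
Proof. by elim/Uq_ind=> x; rewrite !UqE; apply/Uq_piP/cong_mul1r. Qed.
Fact Uq_mulDl : left_distributive Uq_mul Uq_add.
Proof.
elim/Uq_ind=> x; elim/Uq_ind=> y; elim/Uq_ind=> z.
by rewrite !UqE; apply/Uq_piP/cong_mulDl.
Qed.
Fact Uq_mulDr : right_distributive Uq_mul Uq_add.
Proof.
elim/Uq_ind=> x; elim/Uq_ind=> y; elim/Uq_ind=> z.
by rewrite !UqE; apply/Uq_piP/cong_mulDr.
Qed.

Fixpoint Uq_counit (x : term) : F :=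
  match x with
  | TW0 | TW1 | TZero => 0
  | TOne => 1
  | TOpp x => - Uq_counit x
  | TAdd x y => Uq_counit x + Uq_counit y
  | TMul x y => Uq_counit x * Uq_counit y
  | TScale c x => c * Uq_counit x
  end.

Fact Uq_counit_cong x y : cong x y -> Uq_counit x = Uq_counit y.
Proof. by elim=> //=; intros; try congruence; ring. Qed.

Fact Uq_oner_neq0 : Uq_pi TOne != 0.
Proof.
by apply/eqP => /Uq_piP/Uq_counit_cong/eqP; rewrite /= oner_eq0.
Qed.

HB.instance Definition _ := GRing.Zmodule_isNzRing.Build Uq
  Uq_mulA Uq_mul1l Uq_mul1r Uq_mulDl Uq_mulDr Uq_oner_neq0.

Fact Uq_scaleA c e x : Uq_scale c (Uq_scale e x) = Uq_scale (c * e) x.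
Proof. by elim/Uq_ind: x => x; rewrite !UqE; apply/Uq_piP/cong_scaleA. Qed.
Fact Uq_scale1 : left_id 1 Uq_scale.
Proof. by elim/Uq_ind=> x; rewrite !UqE; apply/Uq_piP/cong_scale1. Qed.
Fact Uq_scaleDr : right_distributive Uq_scale +%R.
Proof.
move=> c; elim/Uq_ind=> x; elim/Uq_ind=> y.
by rewrite /GRing.add /= !UqE; apply/Uq_piP/cong_scaleDr.
Qed.
Fact Uq_scaleDl x : {morph Uq_scale^~ x : c e / c + e}.
Proof.
elim/Uq_ind: x => x c e.
by rewrite [in RHS]/GRing.add /= !UqE; apply/Uq_piP/cong_scaleDl.
Qed.

HB.instance Definition _ := GRing.Zmodule_isLmodule.Build F Uq
  Uq_scaleA Uq_scale1 Uq_scaleDr Uq_scaleDl.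

Fact Uq_scaleAl (c : F) (x y : Uq) : c *: (x * y) = (c *: x) * y.
Proof.
elim/Uq_ind: x => x; elim/Uq_ind: y => y.
by rewrite /GRing.scale /GRing.mul /= !UqE; apply/Uq_piP/cong_scaleAl.
Qed.
HB.instance Definition _ :=
  GRing.LSemiModule_isLSemiAlgebra.Build F Uq Uq_scaleAl.

Fact Uq_scaleAr (c : F) (x y : Uq) : c *: (x * y) = x * (c *: y).
Proof.
elim/Uq_ind: x => x; elim/Uq_ind: y => y.
by rewrite /GRing.scale /GRing.mul /= !UqE; apply/Uq_piP/cong_scaleAr.
Qed.
HB.instance Definition _ :=
  GRing.LSemiAlgebra_isSemiAlgebra.Build F Uq Uq_scaleAr.

Lemma Uq_rel0 : comm Uq_W0 (qcomm b^-1 Uq_W0 (qcomm b Uq_W0 Uq_W1)) = 0.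
Proof.
rewrite /comm /qcomm /Uq_W0 /Uq_W1.
rewrite /GRing.add /GRing.opp /GRing.mul /GRing.scale /GRing.zero /= !UqE.
exact/Uq_piP/cong_rel0.
Qed.

Lemma Uq_rel1 : comm Uq_W1 (qcomm b^-1 Uq_W1 (qcomm b Uq_W1 Uq_W0)) = 0.
Proof.
rewrite /comm /qcomm /Uq_W0 /Uq_W1.
rewrite /GRing.add /GRing.opp /GRing.mul /GRing.scale /GRing.zero /= !UqE.
exact/Uq_piP/cong_rel1.
Qed.

End Uq.

Arguments Uq_W0 {F b}.
Arguments Uq_W1 {F b}.

(* A U_q^+-module structure on V: a unital algebra homomorphism to End(V).    *)
Definition Uq_module_action (F : fieldType) (b : F) (V : vectType F)
    (rho : Uq b -> 'End(V)) : Prop :=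
  [/\ linear rho, rho 1 = \1%VF
    & forall x y, rho (x * y) = (rho x \o rho y)%VF].

Section Alternating.
Variables (F : fieldType) (b : F).
Local Notation U := (Uq b).

(* The [n]-th layer consists of W_{-n}, W_{n+1}, G_n and ~G_n.                *)
Record alt_layer := AltLayer { lWn : U; lWp : U; lG : U; lGt : U }.

Definition alt_next (L : nat -> alt_layer) (n : nat) : alt_layer :=
  let G := (1 + b ^- n)^-1 *:
             (\sum_(0 <= k < n) b ^- k *: (lWn (L k) * lWp (L (n - k.+1)%N))
              - \sum_(1 <= k < n) b ^- k *: (lG (L k) * lGt (L (n - k)%N)))
           + ((1 + b ^- n) * (1 - b^-1))^-1 *: comm (lWp (L n.-1)) Uq_W0 in
  let Gt := G + (1 - b^-1)^-1 *: comm Uq_W0 (lWp (L n.-1)) in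
  AltLayer ((b - 1)^-1 *: qcomm b Uq_W0 G) ((b - 1)^-1 *: qcomm b G Uq_W1) G Gt.

(* The layers 0, ..., n, as a function whose values beyond n are irrelevant.  *)
Fixpoint alt_upto (n : nat) : nat -> alt_layer :=
  if n is m.+1 then
    fun k => if (k <= m)%N then alt_upto m k else alt_next (alt_upto m) m.+1
  else fun=> AltLayer Uq_W0 Uq_W1 1 1.

Definition alt (n : nat) : alt_layer := alt_upto n n.

Definition altG (n : nat) : U := lG (alt n).
Definition altGt (n : nat) : U := lGt (alt n).

(* W_k for every integer k; note that [Negz n] is -(n+1).                     *)
Definition altW (k : int) : U :=
  match k with
  | Posz 0 => lWn (alt 0)
  | Posz n.+1 => lWp (alt n)
  | Negz n => lWn (alt n.+1)
  end.

Lemma alt_uptoE n k : (k <= n)%N -> alt_upto n k = alt k.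
Proof.
elim: n => [|n IHn]; first by rewrite leqn0 => /eqP ->.
rewrite leq_eqVlt => /predU1P[->//|]; rewrite ltnS /= => kn.
by rewrite kn IHn.
Qed.

Lemma altWN k : altW (- k%:Z) = lWn (alt k).
Proof. by case: k. Qed.

Lemma altW0 : altW 0 = Uq_W0. Proof. by []. Qed.
Lemma altW1 : altW 1 = Uq_W1. Proof. by []. Qed.
Lemma altG0 : altG 0 = 1. Proof. by []. Qed.
Lemma altGt0 : altGt 0 = 1. Proof. by []. Qed.

Lemma altG_rec n : (0 < n)%N ->
  altG n = (1 + b ^- n)^-1 *:
      (\sum_(0 <= k < n) b ^- k *: (altW (- k%:Z) * altW (n%:Z - k%:Z))
       - \sum_(1 <= k < n) b ^- k *: (altG k * altGt (n - k)%N))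
    + ((1 + b ^- n) * (1 - b^-1))^-1 *: comm (altW n) (altW 0).
Proof.
case: n => // n _; rewrite /altG /alt /= ltnn /=.
congr (_ *: (_ - _) + _ *: comm _ _).
  apply: eq_big_nat => k /andP[_ kn].
  rewrite subSS altWN subzn 1?ltnW // subSn //=.
  by rewrite !alt_uptoE ?leq_subr.
apply: eq_big_nat => k /andP[k0 kn].
by rewrite !alt_uptoE // leq_subLR -addn1 addnC leq_add.
Qed.

Lemma altGt_rec n : (0 < n)%N ->
  altGt n = altG n + (1 - b^-1)^-1 *: comm (altW 0) (altW n).
Proof.
by case: n => // n _; rewrite /altGt /altG /alt /= ltnn.
Qed.

Lemma altWn_rec n : (0 < n)%N ->
  altW (- n%:Z) = (b - 1)^-1 *: qcomm b (altW 0) (altG n).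
Proof. by case: n => // n _; rewrite altWN /altG /alt /= ltnn. Qed.

Lemma altWp_rec n : (0 < n)%N ->
  altW n.+1 = (b - 1)^-1 *: qcomm b (altG n) (altW 1).
Proof. by case: n => // n _; rewrite /altW /altG /alt /= ltnn. Qed.

End Alternating.

Arguments altW {F} b k.
Arguments altG {F} b n.
Arguments altGt {F} b n.

Section ModuleExistence.
Variables (F : fieldType) (b : F) (V : vectType F) (A As : 'End(V)).

Fixpoint Uq_eval (x : Uq_term F) : 'End(V) :=
  match x with
  | TW0 => A
  | TW1 => As
  | TZero => 0
  | TOne => \1%VF
  | TOpp x => - Uq_eval x
  | TAdd x y => Uq_eval x + Uq_eval y
  | TMul x y => (Uq_eval x \o Uq_eval y)%VF
  | TScale c x => c *: Uq_eval x
  end.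

Lemma Uq_module_exists :
  Uq_eval (Tcomm TW0 (Tqcomm b^-1 TW0 (Tqcomm b TW0 TW1))) = 0 ->
  Uq_eval (Tcomm TW1 (Tqcomm b^-1 TW1 (Tqcomm b TW1 TW0))) = 0 ->
  exists rho : Uq b -> 'End(V),
    [/\ Uq_module_action rho, rho Uq_W0 = A & rho Uq_W1 = As].
Proof.
move=> r0 r1.
have evP x y : Uq_cong b x y -> Uq_eval x = Uq_eval y.
  elim=> //=; try by intros; congruence.
  - by move=> *; rewrite addrA.
  - by move=> *; rewrite addrC.
  - by move=> *; rewrite add0r.
  - by move=> *; rewrite addNr.
  - by move=> *; rewrite comp_lfunA.
  - by move=> *; rewrite comp_lfun1l.
  - by move=> *; rewrite comp_lfun1r.
  - by move=> *; rewrite comp_lfunDl.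
  - by move=> *; rewrite comp_lfunDr.
  - by move=> *; rewrite scalerA.
  - by move=> *; rewrite scale1r.
  - by move=> *; rewrite scalerDr.
  - by move=> *; rewrite scalerDl.
  - by move=> *; rewrite comp_lfunZl.
  - by move=> *; rewrite comp_lfunZr.
pose rho (x : Uq b) := Uq_eval (repr x).
have rhoE x : rho (Uq_pi b x) = Uq_eval x by apply: evP; exact: Uq_repr.
exists rho; split; [split | exact: rhoE | exact: rhoE].
- move=> c; elim/Uq_ind=> x; elim/Uq_ind=> y.
  by rewrite /GRing.scale /GRing.add /= Uq_scaleE Uq_addE !rhoE.
- exact: rhoE.
- elim/Uq_ind=> x; elim/Uq_ind=> y.
  by rewrite /GRing.mul /= Uq_mulE !rhoE.
Qed.

End ModuleExistence.

Lemma tridiagonal_Serre (F : fieldType) (V : vectType F) (X Y : 'End(V))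
    (b c : F) d (U : 'I_d.+1 -> {vspace V}) (th : 'I_d.+1 -> F) :
  c != 0 -> c = b \/ c = b^-1 ->
  diagonalizable_end X -> standard_ordering X Y U ->
  (forall i, U i = leigenspace X (th i)) ->
  (forall i j : 'I_d.+1, i = j.+1 :> nat -> th i = c * th j) ->
  Uq_eval X Y (Tcomm TW0 (Tqcomm b^-1 TW0 (Tqcomm b TW0 TW1))) = 0.
Proof.
move=> c0 cb [s sE] [[_ Uall] Utri] Uth thc.
set T := Uq_eval X Y _.
have b0 : b != 0 by case: cb => cE; move: c0; rewrite cE ?invr_eq0.
have XB u v : X (u - v) = X u - X v by exact: linearB.
have XZ a v : X (a *: v) = a *: X v by exact: linearZ.
have YZ a v : Y (a *: v) = a *: Y v by exact: linearZ.
have scC a e (u : V) : a *: (e *: u) = e *: (a *: u).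
  by rewrite !scalerA mulrC.
have lE := (add_lfunE, opp_lfunE, scale_lfunE, id_lfunE, comp_lfunE).
have memU i v : v \in U i -> X v = th i *: v.
  by rewrite Uth memv_ker !lE subr_eq0 => /eqP.
suff TU i v : v \in U i -> T v = 0.
  apply/lfunP => v; rewrite [RHS]lfunE /=.
  have: v \in (\sum_(a <- s) leigenspace X a)%VS by rewrite sE memvf.
  elim: s v {sE} => [|a s IHs] v.
    by rewrite big_nil memv0 => /eqP->; rewrite linear0.
  rewrite big_cons => /memv_addP[u ua [w ws ->]].
  have -> : T (u + w) = T u + T w by exact: linearD.
  rewrite (IHs _ ws) addr0.
  have [->|u0] := eqVneq u 0; first by rewrite linear0.
  have /Uall[i iE] : exists2 a',
      leigenvalue X a' & leigenspace X a = leigenspace X a'.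
    by exists a => //; apply: contraNneq u0 => a0; rewrite -memv0 -a0.
  by apply: (TU i); rewrite -iE.
move=> vi; have Xv := memU _ _ vi.
pose S := ((X - th i *: \1) \o (b^-1 *: X - th i *: \1) \o (b *: X - th i *: \1))%VF.
have TS : T v = S (Y v).
  rewrite /T /S /= !(lE, XZ, XB, YZ, Xv).
  by rewrite !scalerBr !(scC b (th i)) !(scC b^-1 (th i)).
have Sker j : [|| i == j, (i == j.+1 :> nat) | (j == i.+1 :> nat)] ->
    (U j <= lker S)%VS.
  move=> ij; apply/subvP => w /memU Xw; rewrite memv_ker; apply/eqP.
  transitivity ((th j - th i) * (b^-1 * th j - th i) * (b * th j - th i) *: w).
    have st e : (e *: X - th i *: \1)%VF w = (e * th j - th i) *: w.
      by rewrite !lE Xw scalerA -scalerBl.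
    have st1 : (X - th i *: \1)%VF w = (th j - th i) *: w.
      by rewrite !lE Xw -scalerBl.
    have lZ (f : 'End(V)) a u : f (a *: u) = a *: f u by exact: linearZ.
    by rewrite /S !comp_lfunE st lZ st !lZ st1 !scalerA; congr (_ *: _); ring.
  suff -> : (th j - th i) * (b^-1 * th j - th i) * (b * th j - th i) = 0.
    exact: scale0r.
  case/or3P: ij => [/eqP->|/eqP/thc->|/eqP/thc->].
  - by rewrite subrr !mul0r.
  - by case: cb => ->; rewrite subrr ?mulr0 ?mul0r.
  - case: cb => ->; first by rewrite mulKf // subrr mulr0 mul0r.
    by rewrite mulVKf // subrr mulr0.
rewrite TS; apply/eqP; rewrite -memv_ker.
have : Y v \in (Y @: U i)%VS by apply: memv_img.
apply: subvP; apply: subv_trans (Utri i) _.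
rewrite !subv_add -andbA; apply/and3P; split.
- apply/subv_sumP => j /eqP jE; apply: Sker; apply/or3P/Or32/eqP.
  by lia.
- by apply: Sker; rewrite eqxx.
- apply/subv_sumP => j /eqP jE; apply: Sker; apply/or3P/Or33/eqP.
  by lia.
Qed.

Theorem q_Serre_module_exists (F : fieldType) (b : F) (V : vectType F) d
    (A As : 'End(V)) (E Es : 'I_d.+1 -> 'End(V)) :
  b != 0 -> TD_system A E As Es -> q_Serre_type b A E As Es ->
  exists rho : Uq b -> 'End(V),
    [/\ Uq_module_action rho, rho Uq_W0 = A & rho Uq_W1 = As].
Proof.
move=> b0 [[[dA dAs] _ _ _] [U sU UE] [Us sUs UsE]] [th [ths [thE thsE thb]]].
have limgE d' (W : 'I_d'.+1 -> {vspace V}) (P : 'I_d'.+1 -> 'End(V)) X :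
    diagonalizable_end X -> eigenspace_ordering X W ->
    primitive_idempotents W P -> forall i, limg (P i) = W i.
  move=> [s sE] [Winj Wall] WP i; apply: subv_anti; apply/andP; split.
    have: (limg (P i) <= P i @: (\sum_(a <- s) leigenspace X a))%VS by rewrite sE.
    move/subv_trans; apply; rewrite limg_sum.
    elim: s {sE} => [|a s IHs]; first by rewrite big_nil sub0v.
    rewrite big_cons subv_add IHs andbT.
    have [->|a0] := eqVneq (leigenspace X a) 0%VS; first by rewrite limg0 sub0v.
    have [|j ->] := (Wall (leigenspace X a)).2 _; first by exists a.
    apply/subvP => _ /memv_imgP[v vj ->]; rewrite (WP _ _ _ vj).
    by case: eqP => [->//|_]; rewrite mem0v.
  apply/subvP => v vi; apply/memv_imgP; exists v; first exact: memvf.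
  by rewrite (WP _ _ _ vi) eqxx.
have r0 := @tridiagonal_Serre _ _ A As b b d U th b0 (or_introl erefl) dA sU
  (fun i => etrans (esym (limgE _ _ _ _ dA sU.1 UE i)) (thE i))
  (fun i j ij => (thb i j ij).1).
have bV0 : b^-1 != 0 by rewrite invr_eq0.
have r1 := @tridiagonal_Serre _ _ As A b b^-1 d Us ths bV0 (or_intror erefl)
  dAs sUs
  (fun i => etrans (esym (limgE _ _ _ _ dAs sUs.1 UsE i)) (thsE i))
  (fun i j ij => (thb i j ij).2).
exact: Uq_module_exists r0 r1.
Qed.

(* Main.v *)
(** With A = W_0 and B = W_1, induction on n shows that in U_q^+ each layer
    (W_{-n}, W_{n+1}, G_n, ~G_n) satisfies the relations between the layer and
    the two generators that hold in the alternating central extension, in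
    particular [A, W_{-n}] = 0 = [B, W_{n+1}], together with [G_1, G_n] = 0.
    Write Z_n = 0 for the recursion defining G_n, in the form
      sum_{k=0}^n b^{-k} G_k ~G_{n-k} = sum_{k=0}^{n-1} b^{-k} W_{-k} W_{n-k}.
    The bracket of Z_n with A determines [A, G_n], because the sums that arise
    can be evaluated by applying ad G_1 to the identity
      sum_{k=0}^n b^{-k} (W_{-k} G_{n-k} - G_k W_{-(n-k)}) = 0
    one level below; the bracket with B is similar. Finally the bracket of Z_n
    with G_1 reads (b^{-n} - b) [G_1, G_n] = 0.

    It follows that A commutes with W_{-k} and satisfies the cubic q-Serre
    relation with W_{k+1}, and dually for B; hence the actions on the
    eigenspaces of A and of A^*. For the other four decompositions, the
    subspaces P_{i+1} :&: Q_i cut out by the two flags span an invariant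
    subspace, so P_i + Q_i = V for all i, and by modularity
    P_{i+2} :&: Q_i = P_{i+1} :&: Q_i + P_{i+2} :&: Q_{i+1}. *)

Require Import Defs.
From mathcomp Require Import all_boot all_order all_algebra.
From mathcomp Require Import ring zify.

Set Implicit Arguments.
Unset Strict Implicit.
Unset Printing Implicit Defensive.

Import GRing.Theory passmx.
Local Open Scope ring_scope.

(** * Identities between noncommutative polynomials *)

Inductive ncexpr (F : Type) : Type :=
| NCvar of nat | NCone | NCzero
| NCadd of ncexpr F & ncexpr F
| NCopp of ncexpr F
| NCmul of ncexpr F & ncexpr F
| NCscale of F & ncexpr F.
Arguments NCvar {F}.
Arguments NCone {F}.
Arguments NCzero {F}.

(* Plain list functions, so that [cbv] with an explicit list of constants
   evaluates the normal form without unfolding the coefficients in [F]. *)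
Fixpoint same_letter (i j : nat) : bool :=
  match i, j with
  | O, O => true
  | S i', S j' => same_letter i' j'
  | _, _ => false
  end.

Fixpoint same_word (u v : list nat) : bool :=
  match u, v with
  | nil, nil => true
  | cons i u', cons j v' => if same_letter i j then same_word u' v' else false
  | _, _ => false
  end.

Section Normalization.
Variables (F : fieldType) (R : algType F).

Fixpoint nc_eval (env : list R) (e : ncexpr F) : R :=
  match e with
  | NCvar i => nth 0 env i
  | NCone => 1
  | NCzero => 0
  | NCadd x y => nc_eval env x + nc_eval env y
  | NCopp x => - nc_eval env x
  | NCmul x y => nc_eval env x * nc_eval env y
  | NCscale c x => c *: nc_eval env x
  end.

Fixpoint nc_app (A : Type) (s t : list A) : list A :=
  match s with nil => t | cons x s' => cons x (nc_app s' t) end.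

Fixpoint nc_mulmono (c : F) (w : list nat) (p : list (F * list nat)) :=
  match p with
  | nil => nil
  | cons (e, v) p' => cons (c * e, nc_app w v) (nc_mulmono c w p')
  end.

Fixpoint nc_mul (p q : list (F * list nat)) :=
  match p with
  | nil => nil
  | cons (c, w) p' => nc_app (nc_mulmono c w q) (nc_mul p' q)
  end.

Fixpoint nc_norm (e : ncexpr F) : list (F * list nat) :=
  match e with
  | NCvar i => cons (1, cons i nil) nil
  | NCone => cons (1, nil) nil
  | NCzero => nil
  | NCadd x y => nc_app (nc_norm x) (nc_norm y)
  | NCopp x => nc_mulmono (-1) nil (nc_norm x)
  | NCmul x y => nc_mul (nc_norm x) (nc_norm y)
  | NCscale c x => nc_mulmono c nil (nc_norm x)
  end.

Fixpoint nc_coef (w : list nat) (p : list (F * list nat)) : F :=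
  match p with
  | nil => 0
  | cons (c, v) p' => if same_word w v then c + nc_coef w p' else nc_coef w p'
  end.

Fixpoint nc_drop (w : list nat) (p : list (F * list nat)) :=
  match p with
  | nil => nil
  | cons (c, v) p' =>
      if same_word w v then nc_drop w p' else cons (c, v) (nc_drop w p')
  end.

(** The number is fuel. Each round settles the coefficient of the leading word and removes that word
    everywhere, so the length of the list suffices. What remains is a conjunction of equations in
    [F], one for each distinct word. *)
Fixpoint nc_vanish (n : nat) (p : list (F * list nat)) : Prop :=
  match n, p with
  | _, nil => True
  | O, _ => False
  | S m, cons (c, w) p' =>
      c + nc_coef w p' = 0 /\ nc_vanish m (nc_drop w p')
  end.

Definition nc_check (x y : ncexpr F) : Prop :=
  let p := nc_norm (NCadd x (NCopp y)) in nc_vanish (length p) p.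

Fixpoint nc_word (env : list R) (w : list nat) : R :=
  match w with nil => 1 | cons i w' => nth 0 env i * nc_word env w' end.

Fixpoint nc_poly (env : list R) (p : list (F * list nat)) : R :=
  match p with
  | nil => 0
  | cons (c, w) p' => c *: nc_word env w + nc_poly env p'
  end.

Lemma same_wordP u v : same_word u v -> u = v.
Proof.
have letterP i j : same_letter i j -> i = j.
  by elim: i j => [|i IHi] [|j] //= /IHi->.
elim: u v => [|i u IHu] [|j v] //=.
by case: ifP => // /letterP-> /IHu->.
Qed.

Lemma nc_word_app env u v :
  nc_word env (nc_app u v) = nc_word env u * nc_word env v.
Proof. by elim: u => [|i u IHu] /=; rewrite ?mul1r // IHu mulrA. Qed.

Lemma nc_poly_app env p q :
  nc_poly env (nc_app p q) = nc_poly env p + nc_poly env q.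
Proof. by elim: p => [|[c w] p IHp] /=; rewrite ?add0r // IHp addrA. Qed.

Lemma nc_poly_mulmono env c w p :
  nc_poly env (nc_mulmono c w p) = c *: (nc_word env w * nc_poly env p).
Proof.
elim: p => [|[e v] p IHp] /=; first by rewrite mulr0 scaler0.
by rewrite IHp nc_word_app mulrDr scalerDr -scalerAr scalerA.
Qed.

Lemma nc_poly_mul env p q :
  nc_poly env (nc_mul p q) = nc_poly env p * nc_poly env q.
Proof.
elim: p => [|[c w] p IHp] /=; first by rewrite mul0r.
by rewrite nc_poly_app nc_poly_mulmono IHp mulrDl scalerAl.
Qed.

Lemma nc_poly_norm env e : nc_poly env (nc_norm e) = nc_eval env e.
Proof.
elim: e => [i|||x IHx y IHy|x IHx|x IHx y IHy|c x IHx] //=.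
- by rewrite scale1r mulr1 addr0.
- by rewrite scale1r addr0.
- by rewrite nc_poly_app IHx IHy.
- by rewrite nc_poly_mulmono IHx mul1r scaleN1r.
- by rewrite nc_poly_mul IHx IHy.
- by rewrite nc_poly_mulmono IHx mul1r.
Qed.

Lemma nc_poly_split env w p :
  nc_poly env p = nc_coef w p *: nc_word env w + nc_poly env (nc_drop w p).
Proof.
elim: p => [|[c v] p IHp] /=; first by rewrite scale0r add0r.
case: ifP => [/same_wordP<-|_] /=; rewrite [in LHS]IHp.
  by rewrite scalerDl addrA.
by rewrite addrCA.
Qed.

Lemma nc_vanishP env n p : nc_vanish n p -> nc_poly env p = 0.
Proof.
elim: n p => [|n IHn] [|[c w] p] //= [cw /IHn pw].
by rewrite (nc_poly_split _ w) pw addr0 -scalerDl cw scale0r.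
Qed.

Lemma nc_checkP env x y : nc_check x y -> nc_eval env x = nc_eval env y.
Proof.
move=> /(nc_vanishP env); rewrite nc_poly_norm /= => /eqP.
by rewrite subr_eq0 => /eqP.
Qed.

(* A goal follows from hypotheses [e1], [e2]... by exhibiting the difference of
   its sides as a two-sided linear combination of [defect e1], [defect e2]... *)
Definition defect (x y : R) (_ : x = y) : R := x - y.

Lemma defect0 (x y : R) (e : x = y) : defect e = 0.
Proof. by rewrite /defect e subrr. Qed.

Lemma eq_of_defect (z x y : R) : z = 0 -> x - y = z -> x = y.
Proof. by move=> -> /eqP; rewrite subr_eq0 => /eqP. Qed.

End Normalization.

Ltac nc_index x env :=
  lazymatch env with
  | cons x _ => constr:(O)
  | cons _ ?env' => let n := nc_index x env' in constr:(S n)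
  end.

Ltac nc_collect t env :=
  lazymatch t with
  | @GRing.add _ ?x ?y => let env1 := nc_collect x env in nc_collect y env1
  | @GRing.opp _ ?x => nc_collect x env
  | @GRing.mul _ ?x ?y => let env1 := nc_collect x env in nc_collect y env1
  | @GRing.scale _ _ _ ?x => nc_collect x env
  | @GRing.one _ => env
  | @GRing.zero _ => env
  | _ => match env with
         | _ => let n := nc_index t env in env
         | _ => constr:(cons t env)
         end
  end.

Ltac nc_reify F t env :=
  lazymatch t with
  | @GRing.add _ ?x ?y =>
      let ex := nc_reify F x env in let ey := nc_reify F y env in
      constr:(@NCadd F ex ey)
  | @GRing.opp _ ?x => let ex := nc_reify F x env in constr:(@NCopp F ex)
  | @GRing.mul _ ?x ?y =>
      let ex := nc_reify F x env in let ey := nc_reify F y env in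
      constr:(@NCmul F ex ey)
  | @GRing.scale _ _ ?c ?x =>
      let ex := nc_reify F x env in constr:(@NCscale F c ex)
  | @GRing.one _ => constr:(@NCone F)
  | @GRing.zero _ => constr:(@NCzero F)
  | _ => let n := nc_index t env in constr:(@NCvar F n)
  end.

Ltac nc_field :=
  first [ done
        | by ring
        | by field; do ?[apply/andP; split]; do ?apply: expf_neq0 ].

Ltac nc_ring :=
  lazymatch goal with
  | F : fieldType, R : algType _ |- @eq _ ?x ?y =>
    let env0 := nc_collect x (@nil (GRing.Algebra.sort R)) in
    let env := nc_collect y env0 in
    let ex := nc_reify F x env in
    let ey := nc_reify F y env in
    apply: (@nc_checkP F R env ex ey);
    cbv beta iota zeta delta [nc_check nc_vanish nc_norm nc_mul nc_mulmono nc_app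
      nc_coef nc_drop same_word same_letter length];
    repeat (apply: conj); nc_field
  end.

Tactic Notation "nc_using" constr(z) :=
  apply: (@eq_of_defect _ _ (z) _ _);
  [ by rewrite !defect0 ?(mul0r, mulr0, scaler0, oppr0, addr0)
  | rewrite /defect; nc_ring ].

(** * Alternating elements *)

(* Instantiated with (A, W_{-k}, G_k) and with (B, W_{k+1}, ~G_k). *)
Section HalfTower.
Variables (F : fieldType) (R : algType F) (b : F) (a : R) (W G : nat -> R).
Variable n : nat.
Hypotheses (b0 : b != 0) (b1 : b - 1 != 0) (bN1 : b + 1 != 0).
Hypotheses (W0 : W 0 = a) (G0 : G 0 = 1).
Hypothesis aG : forall k, (k <= n)%N ->
  a * G k = b^-1 *: (G k * a) + (1 - b^-1) *: W k.
Hypothesis GG : forall k, (k <= n)%N -> G 1%N * G k = G k * G 1%N.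
Hypothesis GW : forall k, (k < n)%N ->
  G 1%N * W k - W k * G 1%N = G k.+1 * a - a * G k.+1.

(** Apply the bracket with G_1 to the assumed sum. Since G_1 commutes with every G_k, only D_k =
    [G_1, W_k] appears: the sum of b^{-k} D_k G_{n-k} equals that of b^{-k} G_k D_{n-k}. Rewriting
    D_k by [D1] on the left and by [D2] on the right makes the terms G a G cancel and raises the
    level to n+1. The two terms with D_n, which [GW] does not reach, give the right-hand side. *)
Lemma half_tower_sum :
  \sum_(0 <= k < n.+1) b ^- k *: (W k * G (n - k)%N - G k * W (n - k)%N) = 0 ->
  (b - 1) *: \sum_(1 <= k < n.+1)
     b ^- k *: (W k * G (n.+1 - k)%N - G k * W (n.+1 - k)%N)
  = (1 - b ^- n) *: (W n * G 1%N - G 1%N * W n).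
Proof.
move=> I0; pose D k : R := G 1%N * W k - W k * G 1%N.
have D1 k : (k < n)%N -> D k = (1 - b^-1) *: (G k.+1 * a - W k.+1).
  move=> kn; have e := aG kn; rewrite /D.
  nc_using (defect (GW kn) - defect e).
have D2 k : (k < n)%N -> D k = (b - 1) *: (a * G k.+1 - W k.+1).
  move=> kn; have e := aG kn; rewrite /D.
  nc_using (defect (GW kn) - b *: defect e).
have E : \sum_(0 <= k < n.+1) b ^- k *: (D k * G (n - k)%N)
       = \sum_(0 <= k < n.+1) b ^- k *: (G k * D (n - k)%N).
  apply/eqP; rewrite -subr_eq0 -sumrB; apply/eqP.
  transitivity (G 1%N * 0 - 0 * G 1%N : R); last by rewrite mulr0 mul0r subrr.
  rewrite -[X in _ = _ * X - X * _]I0 mulr_sumr mulr_suml -sumrB.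
  apply: eq_big_nat => k /andP[_ kn]; rewrite /D.
  have e1 := GG kn; have e2 := GG (leq_subr k n).
  nc_using (b ^- k *: (defect e1 * W (n - k)%N)
    - b ^- k *: (W k * defect e2)).
pose S (X Y : nat -> R) :=
  \sum_(1 <= k < n.+1) b ^- k *: (X k * Y (n.+1 - k)%N).
have EL : \sum_(0 <= k < n.+1) b ^- k *: (D k * G (n - k)%N)
   = (b - 1) *: (S (fun k => G k * a) G - S W G) + b ^- n *: D n.
  rewrite big_nat_recr //= subnn G0 mulr1; congr (_ + _).
  rewrite /S -sumrB scaler_sumr big_add1 /=; apply: eq_big_nat => k /andP[_ kn].
  rewrite D1 // subSS exprS invfM; nc_ring.
have ER : \sum_(0 <= k < n.+1) b ^- k *: (G k * D (n - k)%N)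
   = (b - 1) *: (S (fun k => G k * a) G - S G W) + D n.
  rewrite big_ltn // expr0 invr1 scale1r subn0 G0 mul1r addrC; congr (_ + _).
  rewrite /S -sumrB scaler_sumr; apply: eq_big_nat => i /andP[i0 iN].
  rewrite D2 ?ltn_subrL ?i0 ?(leq_trans i0) // -?subSn //; nc_ring.
set T := \sum_(1 <= k < n.+1) _; have -> : T = S W G - S G W.
  by rewrite /T /S -sumrB; apply: eq_big_nat => k _; rewrite scalerBr.
move: E; rewrite EL ER {EL ER}; set p := b ^- n.
move: (S W G) (S G W) (S _ G) => x y z E.
have ED : D n = G 1%N * W n - W n * G 1%N by [].
nc_using ((1 - p) *: (- defect ED) - defect E).
Qed.

(** The terms for k = 0 and k = n+1 are split off, and [half_tower_sum] evaluates the rest. *)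
Lemma half_tower_sumS :
  \sum_(0 <= k < n.+1) b ^- k *: (W k * G (n - k)%N - G k * W (n - k)%N) = 0 ->
  a * G n.+1 = b^-1 *: (G n.+1 * a) + (1 - b^-1) *: W n.+1 ->
  G 1%N * W n - W n * G 1%N = G n.+1 * a - a * G n.+1 ->
  \sum_(0 <= k < n.+2)
     b ^- k *: (W k * G (n.+1 - k)%N - G k * W (n.+1 - k)%N) = 0.
Proof.
move=> /half_tower_sum; set T := \sum_(1 <= k < n.+1) _ => hT e1 e2.
rewrite big_ltn // big_nat_recr //= expr0 subn0 subnn G0 W0 exprS.
rewrite invr1 invfM -/T; move: (b ^- n) hT => p; move: T => T hT.
nc_using ((b - 1)^-1 *: defect hT - ((1 - p) / (b - 1)) *: defect e2
  + (1 - b^-1 * p) / (1 - b^-1) *: defect e1).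
Qed.

(** By [aG] both W_1 and W_n are combinations of a G and G a, so [G_1, G_n] = 0 yields the identity
    [E0]. Moving a to the right in b a E0 - E0 a leaves (b - 1)(b + 1) [W_n, W_1]. *)
Lemma half_tower_comm : (0 < n)%N -> a * W 1%N = W 1%N * a ->
  a * W n = W n * a -> W n * W 1%N = W 1%N * W n.
Proof.
move=> n0 K1 Kn; have H1 := aG n0; have Hn := aG (leqnn n).
have C := GG (leqnn n).
have b1' : 1 - b^-1 != 0.
  by rewrite -(inj_eq (mulfI b0)) mulr0 mulrBr mulr1 divff.
have E0 : b *: (W n * G 1%N) - G 1%N * W n
          - b *: (W 1%N * G n) + G n * W 1%N = 0.
  nc_using ((1 - b^-1)^-1 *: (- b *: (defect Hn * G 1%N) + G 1%N * defect Hn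
    + b *: (defect H1 * G n) - G n * defect H1 - b *: (a * defect C)
    + b^-1 *: (defect C * a))).
nc_using (((b - 1) * (b + 1))^-1 *: (b *: (a * defect E0) - defect E0 * a
  - (b ^+ 2 *: (defect Kn * G 1%N) + b ^+ 2 *: (W n * defect H1)
     - b *: (defect H1 * W n) - G 1%N * defect Kn)
  + (b ^+ 2 *: (defect K1 * G n) + b ^+ 2 *: (W 1%N * defect Hn)
     - b *: (defect Hn * W 1%N) - G n * defect K1))).
Qed.

(** Apply X -> b a X - X a to both sides of the last hypothesis. The left side becomes (b - 1)
    [W_1, W_n], which is 0 by [half_tower_comm]; the right side becomes (b - 1) [W_{n+1}, a]. *)
Lemma half_tower_commS : (0 < n)%N -> a * W 1%N = W 1%N * a ->
  a * W n = W n * a ->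
  a * G n.+1 = b^-1 *: (G n.+1 * a) + (1 - b^-1) *: W n.+1 ->
  G 1%N * W n - W n * G 1%N = G n.+1 * a - a * G n.+1 ->
  a * W n.+1 = W n.+1 * a.
Proof.
move=> n0 K1 Kn e1 dS; have dH := half_tower_comm n0 K1 Kn; have d1 := aG n0.
nc_using ((b - 1)^-1 *: (b *: (a * defect dS) - defect dS * a
  + b *: (defect Kn * G 1%N) - G 1%N * defect Kn
  + b *: (W n * defect d1) - b *: (defect d1 * W n)
  + (b - 1) *: defect dH) - (b / (b - 1)) *: (a * defect e1 - defect e1 * a)).
Qed.

End HalfTower.

(** * Relations between the layers and the two generators *)

Section Tower.
Variables (F : fieldType) (R : algType F) (b : F) (A B : R).
Variables Wm Wp G Gt : nat -> R.
Hypotheses (b0 : b != 0) (b_ord : forall n, (0 < n)%N -> b ^+ n != 1).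
Hypotheses (Wm0 : Wm 0 = A) (Wp0 : Wp 0 = B) (G0 : G 0 = 1) (Gt0 : Gt 0 = 1).
Hypothesis Gt_rec : forall n,
  Gt n.+1 = G n.+1 + (1 - b^-1)^-1 *: (A * Wp n - Wp n * A).
Hypothesis Wm_rec : forall n,
  b *: (A * G n.+1) - G n.+1 * A = (b - 1) *: Wm n.+1.
Hypothesis Wp_rec : forall n,
  b *: (G n.+1 * B) - B * G n.+1 = (b - 1) *: Wp n.+1.
Hypothesis Z_rec : forall n,
  Gt n.+1 + b ^- n.+1 *: G n.+1
  + \sum_(1 <= k < n.+1) b ^- k *: (G k * Gt (n.+1 - k)%N)
  = \sum_(0 <= k < n.+1) b ^- k *: (Wm k * Wp (n - k)%N).
Hypothesis Serre0 : comm A (qcomm b^-1 A (qcomm b A B)) = 0.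
Hypothesis Serre1 : comm B (qcomm b^-1 B (qcomm b B A)) = 0.

Record relations n : Prop := Relations {
  rAG : A * G n = b^-1 *: (G n * A) + (1 - b^-1) *: Wm n;
  rBGt : B * Gt n = b^-1 *: (Gt n * B) + (1 - b^-1) *: Wp n;
  rAGt : A * Gt n = b *: (Gt n * A) - (b - 1) *: Wm n;
  rBG : B * G n = b *: (G n * B) - (b - 1) *: Wp n;
  rAWm : A * Wm n = Wm n * A;
  rBWp : B * Wp n = Wp n * B;
  rAWp : A * Wp n - Wp n * A = Wm n * B - B * Wm n;
  rGG : G 1%N * G n = G n * G 1%N;
  rGtGt : Gt 1%N * Gt n = Gt n * Gt 1%N;
  rG_sum : \sum_(0 <= k < n.+1)
     b ^- k *: (Wm k * G (n - k)%N - G k * Wm (n - k)%N) = 0;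
  rGt_sum : \sum_(0 <= k < n.+1)
     b ^- k *: (Wp k * Gt (n - k)%N - Gt k * Wp (n - k)%N) = 0 }.

(** Kept apart from [relations] because each equation involves the layer above: once the layers up
    to [n] are known, these are available only below [n]. *)
Record shifts n : Prop := Shifts {
  sGWm : G 1%N * Wm n - Wm n * G 1%N = G n.+1 * A - A * G n.+1;
  sGWp : G 1%N * Wp n - Wp n * G 1%N = G n.+1 * B - B * G n.+1;
  sGtWp : Gt 1%N * Wp n - Wp n * Gt 1%N = Gt n.+1 * B - B * Gt n.+1 }.

Let b1 : b - 1 != 0.
Proof. by rewrite subr_eq0 -(expr1 b) b_ord. Qed.
Let bN1 : b + 1 != 0.
Proof.
apply: contraNneq (b_ord (ltn0Sn 1)) => /eqP; rewrite addr_eq0 => /eqP->.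
by rewrite sqrrN expr1n.
Qed.

Lemma Z1 : Gt 1%N + b^-1 *: G 1%N = A * B.
Proof.
have := Z_rec 0; rewrite big_geq // big_nat1 addr0 expr1 expr0 invr1 scale1r.
by rewrite Wm0 Wp0.
Qed.

Lemma G1E : b *: (B * A) - A * B = ((b + 1) * (b - 1) / b) *: G 1%N.
Proof.
have := Gt_rec 0; rewrite Wp0 => e.
nc_using ((b - 1) *: (defect e - defect Z1)).
Qed.

Lemma Gt1E : b *: (A * B) - B * A = ((b + 1) * (b - 1) / b) *: Gt 1%N.
Proof.
have := Gt_rec 0; rewrite Wp0 => e.
nc_using (- ((b - 1) / b) *: (defect e + b *: defect Z1)).
Qed.

(** W_{-1} is a multiple of b A G_1 - G_1 A and G_1 one of b B A - A B, so this is [Serre0] up to a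
    nonzero scalar. *)
Lemma comm_A_Wm1 : A * Wm 1%N = Wm 1%N * A.
Proof.
have [S dW hG] := And3 Serre0 (Wm_rec 0) G1E; rewrite /comm /qcomm in S.
nc_using ((b - 1)^-1 *: (defect dW * A - A * defect dW)
  - (b / ((b - 1) ^+ 2 * (b + 1))) *: (b *: defect S
  + A * (b *: (A * defect hG) - defect hG * A)
  - (b *: (A * defect hG) - defect hG * A) * A)).
Qed.

Lemma comm_B_Wp1 : B * Wp 1%N = Wp 1%N * B.
Proof.
have [S dW hG] := And3 Serre1 (Wp_rec 0) G1E; rewrite /comm /qcomm in S.
nc_using ((b - 1)^-1 *: (defect dW * B - B * defect dW)
  - (b / ((b - 1) ^+ 2 * (b + 1))) *: (b *: defect S
  + B * (b *: (defect hG * B) - B * defect hG)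
  - (b *: (defect hG * B) - B * defect hG) * B)).
Qed.

(** * Passage from layer n to layer n+1 *)

Section Step.
Variable n : nat.
Hypothesis rel : forall k, (k <= n)%N -> relations k.
Hypothesis shf : forall k, (k < n)%N -> shifts k.

Let bp : b + b ^- n != 0.
Proof.
have bn1 : b ^+ n.+1 + 1 != 0.
  (* If b^{n+1} = -1, then b^{2(n+1)} = 1. *)
  apply: contraNneq (b_ord (ltn0Sn (n.*2.+1))) => /eqP.
  by rewrite addr_eq0 -doubleS -muln2 exprM => /eqP->; rewrite sqrrN expr1n.
have bn0 : b ^+ n != 0 by rewrite expf_neq0.
by rewrite -(inj_eq (mulfI bn0)) mulr0 mulrDr mulfV // -exprSr.
Qed.

Let Wm_sum := half_tower_sum (a := A) b0 G0
  (fun k kn => rAG (rel kn)) (fun k kn => rGG (rel kn))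
  (fun k kn => sGWm (shf kn)) (rG_sum (rel (leqnn n))).
Let Wp_sum := half_tower_sum (a := B) b0 Gt0
  (fun k kn => rBGt (rel kn)) (fun k kn => rGtGt (rel kn))
  (fun k kn => sGtWp (shf kn)) (rGt_sum (rel (leqnn n))).

(** The bracket of [Z_rec] with [A]. The middle sum contributes [T], which [half_tower_sum]
    evaluates; [rAWp], [rAWm] and [G1E] reduce the remaining terms. The outcome relates [A, G_{n+1}]
    to [W_{-n}, G_1], with the same factor (b + b^{-n}) / b on both, nonzero by [bp]. *)
Lemma step_sGWm : G 1%N * Wm n - Wm n * G 1%N = G n.+1 * A - A * G n.+1.
Proof.
pose T := \sum_(1 <= k < n.+1)
  b ^- k *: (Wm k * G (n.+1 - k)%N - G k * Wm (n.+1 - k)%N).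
pose S := \sum_(1 <= k < n.+1)
  b ^- k *: (G k * Gt (n.+1 - k)%N - Wm k * Wp (n - k)%N).
have hT : (b - 1) *: T = (1 - b ^- n) *: (Wm n * G 1%N - G 1%N * Wm n).
  exact: Wm_sum.
have hZ : Gt n.+1 + (b^-1 * b ^- n) *: G n.+1 + S = A * Wp n.
  have -> : S = \sum_(1 <= k < n.+1) b ^- k *: (G k * Gt (n.+1 - k)%N)
              - \sum_(1 <= k < n.+1) b ^- k *: (Wm k * Wp (n - k)%N).
    by rewrite -sumrB; apply: eq_big_nat => k _; rewrite scalerBr.
  rewrite addrA; have := Z_rec n; rewrite [in RHS]big_ltn // exprS invfM => ->.
  by rewrite expr0 invr1 scale1r Wm0 subn0 addrK.
have hS : A * S - S * A = (1 - b^-1) *: T.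
  rewrite /S /T mulr_sumr mulr_suml scaler_sumr -sumrB.
  apply: eq_big_nat => k /andP[k0 kn].
  have nk : (n - k < n)%N by rewrite ltn_subrL k0 (leq_trans k0).
  rewrite subSn //; have [r1 r2] := (rel kn, rel nk).
  have [e1 e2] := (rAG r1, rAGt r2); have [e3 e4] := (rAWm r1, Gt_rec (n - k)).
  nc_using (b ^- k *: (defect e1 * Gt (n - k).+1 + b^-1 *: (G k * defect e2)
    - defect e3 * Wp (n - k)%N + (1 - b^-1) *: (Wm k * defect e4))).
(* From here the power of b and the sums are atoms for the normalization. *)
have := bp; move: (b ^- n) hZ hT => p hZ hT bp'.
move: S T hS hZ hT => S T hS hZ hT.
have [hK hC hGt] := And3 (rAWp (rel (leqnn n))) (rAWm (rel (leqnn n))) (Gt_rec n).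
have hG := G1E.
nc_using ((b / (b + p)) *: (A * defect hZ - defect hZ * A
  - A * defect hGt + defect hGt * A - defect hS
  - ((1 - b^-1) / (b - 1)) *: defect hT
  + (b - 1)^-1 *: (b *: (defect hK * A) - A * defect hK + b *: (B * defect hC)
    - defect hC * B + Wm n * defect hG - defect hG * Wm n))).
Qed.

(** The bracket of [Z_rec] with [B]. In [S2] only the factors W_{-k} fail to commute with [B], and
    [rAWp] with [Gt_rec] turns [W_{-k}, B] into a multiple of ~G_{k+1} - G_{k+1}. The products
    [G k * Wp (n.+1 - k)] then cancel against those from [S1], which leaves [T]. *)
Lemma step_sGtWp :
  Gt 1%N * Wp n - Wp n * Gt 1%N = Gt n.+1 * B - B * Gt n.+1.
Proof.
pose T := \sum_(1 <= k < n.+1)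
  b ^- k *: (Wp k * Gt (n.+1 - k)%N - Gt k * Wp (n.+1 - k)%N).
pose S1 := \sum_(1 <= k < n.+1) b ^- k *: (G k * Gt (n.+1 - k)%N).
pose S2 := \sum_(0 <= k < n.+1) b ^- k *: (Wm k * Wp (n - k)%N).
have hT : (b - 1) *: T = (1 - b ^- n) *: (Wp n * Gt 1%N - Gt 1%N * Wp n).
  exact: Wp_sum.
have hZ : Gt n.+1 + (b^-1 * b ^- n) *: G n.+1 + S1 = S2.
  by have := Z_rec n; rewrite exprS invfM.
have hS1 : S1 * B - B * S1 = (b - 1) *: \sum_(1 <= k < n.+1)
    b ^- k *: (Wp k * Gt (n.+1 - k)%N - G k * Wp (n.+1 - k)%N).
  rewrite /S1 mulr_sumr mulr_suml scaler_sumr -sumrB.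
  apply: eq_big_nat => k /andP[k0 kn].
  have nk : (n.+1 - k <= n)%N by rewrite leq_subLR -(add1n n) leq_add2r.
  have [e1 e2] := (rBGt (rel nk), rBG (rel (kn : k <= n)%N)).
  nc_using (- (b ^- k) *: (defect e2 * Gt (n.+1 - k)%N)
    - (b * b ^- k) *: (G k * defect e1)).
have hS2 : S2 * B - B * S2 = (b - 1) *: \sum_(1 <= k < n.+1)
    b ^- k *: ((Gt k - G k) * Wp (n.+1 - k)%N)
    + b ^- n *: ((Wm n * B - B * Wm n) * B).
  rewrite /S2 mulr_sumr mulr_suml -sumrB big_nat_recr //= big_add1 scaler_sumr.
  rewrite subnn Wp0; congr (_ + _); last by nc_ring.
  apply: eq_big_nat => k /andP[_ kn]; rewrite subSS exprS invfM.
  have [e1 e2] := (rBWp (rel (leq_subr k n)), rAWp (rel (ltnW kn))).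
  have e3 := Gt_rec k.
  nc_using (- (b ^- k) *: (Wm k * defect e1)
    - b ^- k *: (defect e2 * Wp (n - k)%N)
    - ((1 - b^-1) * b ^- k) *: (defect e3 * Wp (n - k)%N)).
have hS : S1 * B - B * S1 - (S2 * B - B * S2)
    = (b - 1) *: T - b ^- n *: ((Wm n * B - B * Wm n) * B).
  rewrite hS1 hS2 opprD addrA -scalerBr -sumrB; congr (_ *: _ - _).
  by apply: eq_big_nat => k _; nc_ring.
have := bp; move: (b ^- n) hZ hT hS {hS1 hS2} => p hZ hT hS bp'.
move: S1 S2 T hS hZ hT => S1 S2 T hS hZ hT.
have [hK hC hGt] := And3 (rAWp (rel (leqnn n))) (rBWp (rel (leqnn n))) (Gt_rec n).
have hG := Gt1E.
nc_using (- (b / (b + p)) *: (defect hZ * B - B * defect hZ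
  + (p / b) *: (defect hGt * B - B * defect hGt) - p *: (defect hK * B)
  - defect hS - defect hT
  + (p / (b - 1)) *: (defect hG * Wp n - Wp n * defect hG - b *: (A * defect hC)
      + defect hC * A))).
Qed.

(** By [Gt_rec] the difference from [step_sGtWp] amounts to [[A, B], Wp n] = [[A, Wp n], B], the
    Jacobi identity together with [B, Wp n] = 0. *)
Lemma step_sGWp : G 1%N * Wp n - Wp n * G 1%N = G n.+1 * B - B * G n.+1.
Proof.
have [dS hC hGt] := And3 step_sGtWp (rBWp (rel (leqnn n))) (Gt_rec n).
have := Gt_rec 0; rewrite Wp0 => hGt1.
nc_using (defect dS - (defect hGt1 * Wp n - Wp n * defect hGt1)
  + (defect hGt * B - B * defect hGt)
  + (b / (b - 1)) *: (defect hC * A - A * defect hC)).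
Qed.

Lemma step_rAG :
  A * G n.+1 = b^-1 *: (G n.+1 * A) + (1 - b^-1) *: Wm n.+1.
Proof. have e := Wm_rec n; nc_using (b^-1 *: defect e). Qed.

Lemma step_rBG : B * G n.+1 = b *: (G n.+1 * B) - (b - 1) *: Wp n.+1.
Proof. have e := Wp_rec n; nc_using (- defect e). Qed.

Lemma step_rAGt : A * Gt n.+1 = b *: (Gt n.+1 * A) - (b - 1) *: Wm n.+1.
Proof.
have [dS dW hGt] := And3 step_sGWm (Wm_rec n) (Gt_rec n).
have [hK hC hG] := And3 (rAWp (rel (leqnn n))) (rAWm (rel (leqnn n))) G1E.
nc_using ((b + 1) *: defect dS - defect dW + A * defect hGt
  - b *: (defect hGt * A)
  - (b / (b - 1)) *: (b *: (defect hK * A) - A * defect hK + b *: (B * defect hC)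
    - defect hC * B + Wm n * defect hG - defect hG * Wm n)).
Qed.

Lemma step_rBGt :
  B * Gt n.+1 = b^-1 *: (Gt n.+1 * B) + (1 - b^-1) *: Wp n.+1.
Proof.
have [dS dW hGt] := And3 step_sGtWp (Wp_rec n) (Gt_rec n).
have [hC hG] := (rBWp (rel (leqnn n)), Gt1E).
nc_using ((1 + b^-1) *: defect dS + defect hGt * B - b^-1 *: (B * defect hGt)
  + (b - 1)^-1 *: (defect hG * Wp n - Wp n * defect hG - b *: (A * defect hC)
      + defect hC * A) + b^-1 *: defect dW).
Qed.

Lemma step_rAWm : A * Wm n.+1 = Wm n.+1 * A.
Proof.
have [n0|n0] := posnP n; first by rewrite n0; exact: comm_A_Wm1.
exact: (half_tower_commS b0 b1 bN1 (fun k kn => rAG (rel kn))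
  (fun k kn => rGG (rel kn)) n0 comm_A_Wm1 (rAWm (rel (leqnn n))) step_rAG
  step_sGWm).
Qed.

Lemma step_rBWp : B * Wp n.+1 = Wp n.+1 * B.
Proof.
have [n0|n0] := posnP n; first by rewrite n0; exact: comm_B_Wp1.
exact: (half_tower_commS b0 b1 bN1 (fun k kn => rBGt (rel kn))
  (fun k kn => rGtGt (rel kn)) n0 comm_B_Wp1 (rBWp (rel (leqnn n))) step_rBGt
  step_sGtWp).
Qed.

Lemma step_rG_sum : \sum_(0 <= k < n.+2)
  b ^- k *: (Wm k * G (n.+1 - k)%N - G k * Wm (n.+1 - k)%N) = 0.
Proof.
exact: (half_tower_sumS b0 b1 Wm0 G0
  (fun k kn => rAG (rel kn)) (fun k kn => rGG (rel kn))
  (fun k kn => sGWm (shf kn)) (rG_sum (rel (leqnn n))) step_rAG step_sGWm).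
Qed.

Lemma step_rGt_sum : \sum_(0 <= k < n.+2)
  b ^- k *: (Wp k * Gt (n.+1 - k)%N - Gt k * Wp (n.+1 - k)%N) = 0.
Proof.
exact: (half_tower_sumS b0 b1 Wp0 Gt0
  (fun k kn => rBGt (rel kn)) (fun k kn => rGtGt (rel kn))
  (fun k kn => sGtWp (shf kn)) (rGt_sum (rel (leqnn n))) step_rBGt step_sGtWp).
Qed.

(** G_1 differs by a multiple of [A, B] from ~G_1, which commutes with ~G_k; [A] and [B] are carried
    across ~G_k by [rAGt] and [rBGt]. *)
Lemma comm_G1_Gt k : relations k ->
  G 1%N * Gt k - Gt k * G 1%N = (b - 1) *: (A * Wp k - Wm k * B).
Proof.
move=> r; have := Gt_rec 0; rewrite Wp0 => d0.
have [hK hc] := (rAWp r, rGtGt r); have [d1 d2] := (rAGt r, rBGt r).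
nc_using (defect hc - (b / (b - 1)) *: ((b - 1) *: defect hK
  + b^-1 *: (defect d1 * B) + A * defect d2 - b *: (defect d2 * A)
  - B * defect d1) - (defect d0 * Gt k - Gt k * defect d0)).
Qed.

(* The two sides of [rAWp] are brackets computed from the same G_{n+1}, so they
   differ by a bracket of G_{n+1} with G_1, which is still unknown here. *)
Lemma step_K :
  A * Wp n.+1 - Wp n.+1 * A - (Wm n.+1 * B - B * Wm n.+1)
  = ((b + 1) / b) *: (G 1%N * G n.+1 - G n.+1 * G 1%N).
Proof.
have [dWm dWp hG] := And3 (Wm_rec n) (Wp_rec n) G1E.
nc_using ((b - 1)^-1 *: (defect hG * G n.+1 - G n.+1 * defect hG
  - A * defect dWp + defect dWp * A + defect dWm * B - B * defect dWm)).
Qed.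

(** ~G_1 is a multiple of b A B - B A, and carrying [A] and [B] across ~G_{n+1} produces the left
    side of [step_K]. Thus both commutators are one and the same unknown. *)
Lemma step_comm_Gt1_Gt : Gt 1%N * Gt n.+1 - Gt n.+1 * Gt 1%N
  = G 1%N * G n.+1 - G n.+1 * G 1%N.
Proof.
have [e1 hG] := (step_K, Gt1E); have [dA dB] := (step_rAGt, step_rBGt).
nc_using ((b / ((b + 1) * (b - 1))) *: ((b - 1) *: defect e1
  - defect hG * Gt n.+1 + Gt n.+1 * defect hG
  + b *: (A * defect dB - defect dB * A) + defect dA * B - B * defect dA)).
Qed.

(** The analogue of [comm_G1_Gt] at layer n+1, keeping the terms whose vanishing is still to be
    shown. *)
Lemma step_comm_G1_Gt : G 1%N * Gt n.+1 - Gt n.+1 * G 1%N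
  = Gt 1%N * Gt n.+1 - Gt n.+1 * Gt 1%N
    - b *: (A * Wp n.+1 - Wp n.+1 * A - (Wm n.+1 * B - B * Wm n.+1))
    + (b - 1) *: (A * Wp n.+1 - Wm n.+1 * B).
Proof.
have := Gt_rec 0; rewrite Wp0 => d0; have [d1 d2] := (step_rAGt, step_rBGt).
nc_using (- (b / (b - 1)) *: (b^-1 *: (defect d1 * B) + A * defect d2
  - b *: (defect d2 * A) - B * defect d1)
  - (defect d0 * Gt n.+1 - Gt n.+1 * defect d0)).
Qed.

Lemma step_rGG : G 1%N * G n.+1 = G n.+1 * G 1%N.
Proof.
(* At k = n the shifts lie outside [shf] and come from the lemmas just proved. *)
have sA k : (k < n.+1)%N ->
    G 1%N * Wm k - Wm k * G 1%N = (1 - b^-1) *: (G k.+1 * A - Wm k.+1).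
  rewrite ltnS leq_eqVlt => /predU1P[->|kn].
    have [dS e] := (step_sGWm, step_rAG); nc_using (defect dS - defect e).
  have [dS e] := (sGWm (shf kn), rAG (rel kn)); nc_using (defect dS - defect e).
have sB k : (k < n.+1)%N ->
    G 1%N * Wp k - Wp k * G 1%N = (b - 1) *: (Wp k.+1 - G k.+1 * B).
  rewrite ltnS leq_eqVlt => /predU1P[->|kn].
    have [dS e] := (step_sGWp, step_rBG); nc_using (defect dS - defect e).
  have [dS e] := (sGWp (shf kn), rBG (rel kn)); nc_using (defect dS - defect e).
pose S1 := \sum_(1 <= k < n.+1) b ^- k *: (G k * Gt (n.+1 - k)%N).
pose S2 := \sum_(0 <= k < n.+1) b ^- k *: (Wm k * Wp (n - k)%N).
(* These four sums occur in the brackets of [S1] and [S2] with G_1. In the difference [X] and [M]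
   cancel, and [Y] and [L] are removed by [hI] multiplied by [B] on the right; [hI] is [step_rG_sum]
   with its end terms split off. *)
pose X := \sum_(1 <= k < n.+1) b ^- k *: (G k * A * Wp (n.+1 - k)%N).
pose Y := \sum_(1 <= k < n.+1) b ^- k *: (G k * Wm (n.+1 - k)%N).
pose L := \sum_(1 <= k < n.+1) b ^- k *: (Wm k * G (n.+1 - k)%N).
pose M := \sum_(1 <= k < n.+1) b ^- k *: (Wm k * Wp (n.+1 - k)%N).
have hZ : Gt n.+1 + b ^- n.+1 *: G n.+1 + S1 = S2 by exact: Z_rec.
have hI : A * G n.+1 - Wm n.+1 + (L - Y)
    + b ^- n.+1 *: (Wm n.+1 - G n.+1 * A) = 0.
  rewrite -step_rG_sum big_ltn // big_nat_recr //= subn0 subnn G0 Wm0 expr0.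
  rewrite invr1 scale1r mul1r mulr1 -[LHS]addrA; congr (_ + (_ + _)).
  by rewrite /L /Y -sumrB; apply: eq_big_nat => k _; rewrite scalerBr.
have hS1 : G 1%N * S1 - S1 * G 1%N = (b - 1) *: (X - Y * B).
  rewrite /S1 /X /Y mulr_sumr !mulr_suml -!sumrB scaler_sumr.
  apply: eq_big_nat => k /andP[k0 kn].
  have nk : (n.+1 - k <= n)%N by rewrite leq_subLR -(add1n n) leq_add2r.
  have [e1 e2] := (rGG (rel (kn : k <= n)%N), comm_G1_Gt (rel nk)).
  nc_using (b ^- k *: (defect e1 * Gt (n.+1 - k)%N + G k * defect e2)).
have hS2 : G 1%N * S2 - S2 * G 1%N
    = (b - 1) *: (X + b ^- n.+1 *: ((G n.+1 * A - Wm n.+1) * B) - M)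
      + (b - 1) *: (A * Wp n.+1 + M - (A * G n.+1 + L) * B).
  have -> : X + b ^- n.+1 *: ((G n.+1 * A - Wm n.+1) * B) - M =
      \sum_(1 <= k < n.+2) b ^- k *: ((G k * A - Wm k) * Wp (n.+1 - k)%N).
    rewrite /X /M [RHS]big_nat_recr //= subnn Wp0 addrAC -sumrB; congr (_ + _).
    by apply: eq_big_nat => k _; nc_ring.
  have -> : A * Wp n.+1 + M - (A * G n.+1 + L) * B =
      \sum_(0 <= k < n.+1) b ^- k *: (Wm k * (Wp (n - k).+1 - G (n - k).+1 * B)).
    rewrite /L /M [RHS]big_ltn // expr0 invr1 scale1r subn0 Wm0 mulrDl mulr_suml.
    rewrite opprD addrACA -sumrB; congr (_ + _); first by nc_ring.
    by apply: eq_big_nat => k /andP[_ kn]; rewrite subSn //; nc_ring.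
  rewrite /S2 mulr_sumr mulr_suml big_add1 /= !scaler_sumr -sumrB -big_split /=.
  apply: eq_big_nat => k /andP[_ kn]; rewrite subSS exprS invfM.
  have [e1 e2] := (sA k kn, sB (n - k)%N (leq_subr k n)).
  nc_using (b ^- k *: (defect e1 * Wp (n - k)%N + Wm k * defect e2)).
have hS : G 1%N * S1 - S1 * G 1%N - (G 1%N * S2 - S2 * G 1%N)
    = (b - 1) *: (Wm n.+1 * B - A * Wp n.+1).
  rewrite hS1 hS2; move: (X) (Y) (L) (M) hI => x y l m {}hI.
  nc_using ((b - 1) *: (defect hI * B)).
(* Equality would give b^{n+2} = 1. *)
have bq : b ^- n.+1 - b != 0.
  have bN0 : b ^+ n.+1 != 0 by rewrite expf_neq0.
  rewrite -(inj_eq (mulfI bN0)) mulr0 mulrBr mulfV // -exprSr subr_eq0 eq_sym.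
  exact: b_ord.
have [e1 e2 e3] := And3 step_K step_comm_Gt1_Gt step_comm_G1_Gt.
clear hI hS1 hS2; move: (b ^- n.+1) S1 S2 hZ hS bq => p S1 S2 hZ hS bq.
nc_using ((p - b)^-1 *: (G 1%N * defect hZ - defect hZ * G 1%N
  - defect e3 - defect e2 + b *: defect e1 - defect hS)).
Qed.

Lemma step_rAWp : A * Wp n.+1 - Wp n.+1 * A = Wm n.+1 * B - B * Wm n.+1.
Proof.
by apply/eqP; rewrite -subr_eq0 step_K step_rGG subrr scaler0.
Qed.

Lemma step_rGtGt : Gt 1%N * Gt n.+1 = Gt n.+1 * Gt 1%N.
Proof. by apply/eqP; rewrite -subr_eq0 step_comm_Gt1_Gt step_rGG subrr. Qed.

Lemma step_relations : relations n.+1.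
Proof.
split; [exact: step_rAG | exact: step_rBGt | exact: step_rAGt | exact: step_rBG
  | exact: step_rAWm | exact: step_rBWp | exact: step_rAWp | exact: step_rGG
  | exact: step_rGtGt | exact: step_rG_sum | exact: step_rGt_sum].
Qed.

Lemma step_shifts : shifts n.
Proof. split; [exact: step_sGWm | exact: step_sGWp | exact: step_sGtWp]. Qed.

End Step.

Lemma relations0 : relations 0.
Proof.
split; rewrite ?G0 ?Gt0 ?Wm0 ?Wp0 ?big_nat1 ?G0 ?Gt0 ?Wm0 ?Wp0 //; try nc_ring.
Qed.

Lemma tower_relations n : relations n.
Proof.
suff [] : (forall k, (k <= n)%N -> relations k)
       /\ (forall k, (k < n)%N -> shifts k) by move=> + _; apply.
elim: n => [|n [rel shf]].
  by split=> k //; rewrite leqn0 => /eqP->; exact: relations0.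
split=> k; rewrite leq_eqVlt => /predU1P[E|kn].
- by rewrite E; exact: step_relations.
- exact: rel.
- by case: E => ->; exact: step_shifts.
- exact: shf.
Qed.

Lemma tower_comm_Wm n : Wm n * Wm 1%N = Wm 1%N * Wm n.
Proof.
have [->|n0] := posnP n; first by rewrite Wm0 comm_A_Wm1.
exact: (half_tower_comm b0 b1 bN1 (fun k _ => rAG (tower_relations k))
  (fun k _ => rGG (tower_relations k)) n0 comm_A_Wm1 (rAWm (tower_relations n))).
Qed.

Lemma tower_comm_Wp n : Wp n * Wp 1%N = Wp 1%N * Wp n.
Proof.
have [->|n0] := posnP n; first by rewrite Wp0 comm_B_Wp1.
exact: (half_tower_comm b0 b1 bN1 (fun k _ => rBGt (tower_relations k))
  (fun k _ => rGtGt (tower_relations k)) n0 comm_B_Wp1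
  (rBWp (tower_relations n))).
Qed.

(** The three brackets with [A] commute, so the plain one can be applied first: [A, Wp n] =
    [Wm n, B]. As [A] commutes with [Wm n], the other two act on [B] alone, turning it first into a
    multiple of G_1 and then into one of W_{-1}; and [Wm n, Wm 1] = 0. *)
Lemma tower_cubic0 n : comm A (qcomm b^-1 A (qcomm b A (Wp n))) = 0.
Proof.
have [r r1] := (tower_relations n, tower_relations 1).
have [dK dC d1] := And3 (rAWp r) (rAWm r) (rAG r1).
have [hG dH] := (G1E, tower_comm_Wm n); rewrite /comm /qcomm.
nc_using (b *: (A * (b^-1 *: (A * defect dK) - defect dK * A))
  - (b^-1 *: (A * defect dK) - defect dK * A) * A
  + (b *: (A * (b^-1 *: (defect dC * B) - B * defect dC))
     - (b^-1 *: (defect dC * B) - B * defect dC) * A)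
  - b^-1 *: (b *: (A * (Wm n * defect hG - defect hG * Wm n))
     - (Wm n * defect hG - defect hG * Wm n) * A)
  - ((b + 1) * (b - 1) / b ^+ 2) *: (b *: (defect dC * G 1%N)
     - G 1%N * defect dC + b *: (Wm n * defect d1) - b *: (defect d1 * Wm n)
     + (b - 1) *: defect dH)).
Qed.

Lemma tower_cubic1 n : comm B (qcomm b^-1 B (qcomm b B (Wm n))) = 0.
Proof.
have [r r1] := (tower_relations n, tower_relations 1).
have [dK dC d1] := And3 (rAWp r) (rBWp r) (rBGt r1).
have [hG dH] := (Gt1E, tower_comm_Wp n); rewrite /comm /qcomm.
nc_using (b *: (B * (b^-1 *: (B * defect dK) - defect dK * B))
  - (b^-1 *: (B * defect dK) - defect dK * B) * B
  + (b *: (B * (b^-1 *: (defect dC * A) - A * defect dC))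
     - (b^-1 *: (defect dC * A) - A * defect dC) * B)
  - b^-1 *: (b *: (B * (Wp n * defect hG - defect hG * Wp n))
     - (Wp n * defect hG - defect hG * Wp n) * B)
  - ((b + 1) * (b - 1) / b ^+ 2) *: (b *: (defect dC * Gt 1%N)
     - Gt 1%N * defect dC + b *: (Wp n * defect d1) - b *: (defect d1 * Wp n)
     + (b - 1) *: defect dH)).
Qed.

End Tower.

(** * The alternating elements of U_q^+ as an instance *)

Lemma alternating_recursion_sum (F : fieldType) (R : algType F) (b p : F)
    (g gt u w s1 s2 : R) :
  1 + p != 0 -> 1 - b^-1 != 0 ->
  g = (1 + p)^-1 *: (s2 - s1) + ((1 + p) * (1 - b^-1))^-1 *: (w * u - u * w) ->
  gt = g + (1 - b^-1)^-1 *: (u * w - w * u) ->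
  gt + p *: g + s1 = s2.
Proof.
move=> p1; set c := 1 - b^-1; move: c => c c0 hg hgt.
nc_using (defect hgt + (1 + p) *: defect hg).
Qed.

Section AlternatingElements.
Variables (F : fieldType) (b : F).
Hypotheses (b0 : b != 0) (b_ord : forall n, (0 < n)%N -> b ^+ n != 1).

Let Wm k := altW b (- k%:Z).
Let Wp k := altW b k.+1.
Let Gt_rec n : altGt b n.+1 = altG b n.+1
  + (1 - b^-1)^-1 *: (Uq_W0 * Wp n - Wp n * Uq_W0).
Proof. by rewrite altGt_rec. Qed.

Let b1 : b - 1 != 0.
Proof. by rewrite subr_eq0 -(expr1 b) b_ord. Qed.

Let Wm_rec n : b *: (Uq_W0 * altG b n.+1) - altG b n.+1 * Uq_W0
  = (b - 1) *: Wm n.+1.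
Proof. by rewrite /Wm altWn_rec // scalerA mulfV // scale1r. Qed.

Let Wp_rec n : b *: (altG b n.+1 * Uq_W1) - Uq_W1 * altG b n.+1
  = (b - 1) *: Wp n.+1.
Proof. by rewrite /Wp altWp_rec // scalerA mulfV // scale1r. Qed.

Let Z_rec n : altGt b n.+1 + b ^- n.+1 *: altG b n.+1
  + \sum_(1 <= k < n.+1) b ^- k *: (altG b k * altGt b (n.+1 - k)%N)
  = \sum_(0 <= k < n.+1) b ^- k *: (Wm k * Wp (n - k)%N).
Proof.
have bN0 : b ^+ n.+1 != 0 by rewrite expf_neq0.
apply: alternating_recursion_sum (Gt_rec n).
- rewrite -(inj_eq (mulfI bN0)) mulr0 mulrDr mulr1 mulfV //.
  apply: contraNneq (b_ord (ltn0Sn (n.*2.+1))) => /eqP.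
  by rewrite addr_eq0 -doubleS -muln2 exprM => /eqP->; rewrite sqrrN expr1n.
- by rewrite -(inj_eq (mulfI b0)) mulr0 mulrBr mulr1 divff.
rewrite [LHS]altG_rec //; congr (_ *: (_ - _) + _).
apply: eq_big_nat => k /andP[_ kn]; rewrite /Wm /Wp.
by rewrite subzn ?subSn // ltnW.
Qed.

Let rels := tower_relations b0 b_ord erefl erefl erefl erefl Gt_rec Wm_rec Wp_rec
  Z_rec (Uq_rel0 b) (Uq_rel1 b).

Lemma alt_comm_W0 k : Uq_W0 * altW b (- k%:Z) = altW b (- k%:Z) * Uq_W0.
Proof. exact: rAWm (rels k). Qed.

Lemma alt_comm_W1 k : Uq_W1 * altW b k.+1 = altW b k.+1 * Uq_W1.
Proof. exact: rBWp (rels k). Qed.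

Lemma alt_cubic_W0 k :
  comm Uq_W0 (qcomm b^-1 Uq_W0 (qcomm b Uq_W0 (altW b k.+1))) = 0.
Proof.
exact: (tower_cubic0 b0 b_ord erefl erefl erefl erefl Gt_rec Wm_rec Wp_rec
  Z_rec (Uq_rel0 b) (Uq_rel1 b)).
Qed.

Lemma alt_cubic_W1 k :
  comm Uq_W1 (qcomm b^-1 Uq_W1 (qcomm b Uq_W1 (altW b (- k%:Z)))) = 0.
Proof.
exact: (tower_cubic1 b0 b_ord erefl erefl erefl erefl Gt_rec Wm_rec Wp_rec
  Z_rec (Uq_rel0 b) (Uq_rel1 b)).
Qed.

End AlternatingElements.

(** * Split decompositions *)

Section SplitFlags.
Variables (F : fieldType) (V : vectType F) (A As : 'End(V)) (d : nat).
Hypothesis irr : forall W : {vspace V},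
  (A @: W <= W)%VS -> (As @: W <= W)%VS -> W = 0%VS \/ W = fullv.
Variables (P Q : nat -> {vspace V}) (x y : nat -> F).
Hypotheses (Psub : forall i, (P i <= P i.+1)%VS)
           (Qsub : forall i, (Q i.+1 <= Q i)%VS).
Hypotheses (P0 : P 0 = 0%VS) (P1 : P 1 <> 0%VS).
Hypotheses (Q0 : Q 0 = fullv) (Qd : Q d.+1 = 0%VS).
Hypotheses (AP : forall i, (A @: P i <= P i.+1)%VS)
           (AsQ : forall i, (As @: Q i.+1 <= Q i)%VS).
Hypothesis AQ : forall i v, v \in Q i -> A v - y i *: v \in Q i.+1.
Hypothesis AsP : forall i v, v \in P i.+1 -> As v - x i *: v \in P i.

Lemma flag_le (i j : nat) : (i <= j)%N -> (P i <= P j)%VS /\ (Q j <= Q i)%VS.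
Proof.
elim: j => [|j IHj]; first by rewrite leqn0 => /eqP->.
rewrite leq_eqVlt => /predU1P[->|/IHj[pij qji]]; first by [].
by split; [apply: subv_trans (Psub j) | apply: subv_trans qji].
Qed.

(** With M_i = P_{i+1} :&: Q_i, the map A - y_i sends M_i into M_{i+1} and As - x_i sends M_i into
    M_{i-1}. The sum is therefore invariant, and it contains M_0 = P_1, which is nonzero. *)
Lemma split_sum : (\sum_(i < d.+1) (P i.+1 :&: Q i))%VS = fullv.
Proof.
pose M i := (P i.+1 :&: Q i)%VS; set S := (\sum_(i < d.+1) _)%VS.
(* Beyond [d] the component is 0 because [Q d.+1] is. *)
have MS i v : v \in M i -> v \in S.
  have [id|di] := ltnP i d.+1.
    by apply: subvP; apply: (sumv_sup (Ordinal id)).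
  case/memv_capP=> _; have [_ /subvP/[apply]] := flag_le di.
  by rewrite Qd memv0 => /eqP->; rewrite mem0v.
have inv (f : 'End(V)) : (forall i v, v \in M i -> f v \in S) -> (f @: S <= S)%VS.
  move=> fM; rewrite limg_sum; apply/subv_sumP => i _.
  by apply/subvP => _ /memv_imgP[v vi ->]; exact: fM vi.
have [|||//] := irr (W := S).
- apply: inv => i v vi; rewrite -(subrK (y i *: v) (A v)) memvD ?memvZ //.
    apply: (MS i.+1); case/memv_capP: vi => vP vQ; rewrite memv_cap AQ // andbT.
    rewrite memvB ?memvZ ?(subvP (Psub _) _ vP) //.
    by apply: (subvP (AP _)); apply: memv_img.
  exact: MS vi.
- apply: inv => i v vi; rewrite -(subrK (x i *: v) (As v)) memvD ?memvZ //.
    case/memv_capP: vi => vP vQ; have := AsP vP.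
    case: i vP vQ => [|i] vP vQ.
      by rewrite P0 memv0 => /eqP->; rewrite mem0v.
    move=> e; apply: (MS i); rewrite memv_cap e memvB ?memvZ //.
      by apply: (subvP (AsQ _)); apply: memv_img.
    exact: subvP (Qsub _) _ vQ.
  exact: MS vi.
move=> S0; case: P1; apply/eqP; rewrite -subv0 -S0.
by apply: (sumv_sup ord0) => //=; rewrite Q0 capvf.
Qed.

(** In [split_sum] the summand of index j lies in P_i when j < i and in Q_i otherwise. *)
Lemma split_add i : (P i + Q i)%VS = fullv.
Proof.
apply/eqP; rewrite eqEsubv subvf -split_sum /=; apply/subv_sumP => j _.
have [ji|ij] := ltnP j i.
  apply: subv_trans (addvSl _ _); apply: subv_trans (capvSl _ _) _.
  by have [] := flag_le ji.
apply: subv_trans (addvSr _ _); apply: subv_trans (capvSr _ _) _.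
by have [] := flag_le ij.
Qed.

Lemma split_step i :
  (P i.+2 :&: Q i <= (P i.+1 :&: Q i) + (P i.+2 :&: Q i.+1))%VS.
Proof.
apply/subvP => v /memv_capP[vP vQ].
have /memv_addP[u uP [w wQ def_v]] : v \in (P i.+1 + Q i.+1)%VS.
  by rewrite split_add memvf.
apply/memv_addP; exists u; last exists w => //; rewrite memv_cap ?uP ?wQ ?andbT /=.
  by rewrite -(addrK w u) -def_v memvB // (subvP (Qsub _) _ wQ).
by rewrite -(addKr u w) -def_v memvD // memvN (subvP (Psub _) _ uP).
Qed.

End SplitFlags.

(** * Flags attached to an ordered family of subspaces *)

Section OrderedFamily.
Variables (F : fieldType) (V : vectType F) (d : nat).
Implicit Types (X : 'I_d.+1 -> {vspace V}) (f : 'End(V)).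

Definition tri_action X f : Prop := forall i : 'I_d.+1,
  (f @: X i <= \sum_(j < d.+1 | (i <= j.+1)%N && (j <= i.+1)%N) X j)%VS.
Definition diag_action X f : Prop := forall i, (f @: X i <= X i)%VS.

(** The bound is strict so that [low X 0] is 0, as the flag [P] of the split lemmas requires; the
    inclusive bound in [high] makes [high X 0] the sum of the whole family. *)
Definition low X (i : nat) : {vspace V} := (\sum_(j < d.+1 | (j < i)%N) X j)%VS.
Definition high X (i : nat) : {vspace V} :=
  (\sum_(j < d.+1 | (i <= j)%N) X j)%VS.

Lemma sum_memv X (p : pred 'I_d.+1) j v :
  p j -> v \in X j -> v \in (\sum_(i | p i) X i)%VS.
Proof. by move=> pj; apply: subvP; apply: (sumv_sup j). Qed.

Lemma limg_sum_sub X f (p : pred 'I_d.+1) (W : {vspace V}) :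
  (forall i v, p i -> v \in X i -> f v \in W) ->
  (f @: (\sum_(i | p i) X i) <= W)%VS.
Proof.
move=> fW; rewrite limg_sum; apply/subv_sumP => i pi.
by apply/subvP => _ /memv_imgP[v vi ->]; exact: fW pi vi.
Qed.

Lemma tri_low X f : tri_action X f -> forall i, (f @: low X i <= low X i.+1)%VS.
Proof.
move=> fX i; apply: limg_sum_sub => j v ji vj.
apply: subvP (memv_img f vj); apply: subv_trans (fX j) _.
apply/subv_sumP => k /andP[_ kj]; apply: (sumv_sup k) => //.
by rewrite ltnS (leq_trans kj).
Qed.

Lemma tri_high X f : tri_action X f ->
  forall i, (f @: high X i.+1 <= high X i)%VS.
Proof.
move=> fX i; apply: limg_sum_sub => j v ij vj.
apply: subvP (memv_img f vj); apply: subv_trans (fX j) _.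
apply/subv_sumP => k /andP[jk _]; apply: (sumv_sup k) => //.
by rewrite -ltnS (leq_trans ij).
Qed.

Lemma diag_sum X f (p : pred 'I_d.+1) : diag_action X f ->
  (f @: (\sum_(i | p i) X i) <= \sum_(i | p i) X i)%VS.
Proof.
move=> fX; apply: limg_sum_sub => j v pj vj; apply: sum_memv pj _.
by apply: (subvP (fX j)); exact: memv_img.
Qed.

Variables (f : 'End(V)) (X : 'I_d.+1 -> {vspace V}) (th : 'I_d.+1 -> F).
Hypothesis fX : forall i v, v \in X i -> f v = th i *: v.

Lemma eigen_peel (p q : pred 'I_d.+1) (c : F) :
  (forall i, p i -> ~~ q i -> th i = c) ->
  forall v, v \in (\sum_(i | p i) X i)%VS ->
    f v - c *: v \in (\sum_(i | q i) X i)%VS.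
Proof.
move=> pq v vp; pose g := (f - c *: \1)%VF.
have gE u : g u = f u - c *: u.
  by rewrite /g add_lfunE opp_lfunE scale_lfunE id_lfunE.
rewrite -gE; apply: subvP (memv_img g vp).
apply: limg_sum_sub => i u pi ui; rewrite gE (fX ui) -scalerBl.
have [qi|nqi] := boolP (q i); first by rewrite memvZ // (sum_memv qi).
by rewrite pq // subrr scale0r mem0v.
Qed.

(** For [i] above [d] the scalar given by [inord] is a mere default, harmless since [low X i.+1] and
    [low X i] then coincide. *)
Lemma eigen_low : forall i v, v \in low X i.+1 ->
  f v - th (inord i) *: v \in low X i.
Proof.
move=> i; apply: eigen_peel => j; rewrite ltnS leq_eqVlt => /orP[/eqP<- _|->] //.
by rewrite inord_val.
Qed.

Lemma eigen_high : forall i v, v \in high X i ->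
  f v - th (inord i) *: v \in high X i.+1.
Proof.
move=> i; apply: eigen_peel => j; rewrite leq_eqVlt => /orP[/eqP-> _|->] //.
by rewrite inord_val.
Qed.

End OrderedFamily.

Section SplitDecomposition.
Variables (F : fieldType) (V : vectType F) (A As : 'End(V)) (d : nat).
Hypothesis irr : forall W : {vspace V},
  (A @: W <= W)%VS -> (As @: W <= W)%VS -> W = 0%VS \/ W = fullv.
Variables (X Y : 'I_d.+1 -> {vspace V}) (x y : 'I_d.+1 -> F).
Hypotheses (AsX : forall i v, v \in X i -> As v = x i *: v)
           (AY : forall i v, v \in Y i -> A v = y i *: v).
Hypotheses (AX : tri_action X A) (AsY : tri_action Y As).
Hypotheses (X0 : X ord0 <> 0%VS) (Ysum : (\sum_i Y i)%VS = fullv).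

Definition split_dec (i : 'I_d.+1) : {vspace V} := (low X i.+1 :&: high Y i)%VS.

Lemma low_high_step i : (low X i.+2 :&: high Y i
  <= (low X i.+1 :&: high Y i) + (low X i.+2 :&: high Y i.+1))%VS.
Proof.
have lowS k : (low X k <= low X k.+1)%VS.
  by apply/subv_sumP => j jk; apply: (sumv_sup j) => //; exact: ltnW.
have highS k : (high Y k.+1 <= high Y k)%VS.
  by apply/subv_sumP => j jk; apply: (sumv_sup j) => //; exact: ltnW.
apply: (split_step (d := d) irr lowS highS _ _ _ _ (tri_low AX) (tri_high AsY)
  (eigen_high AY) (eigen_low AsX)).
- by apply: big1.
- move=> X1; apply: X0; apply/eqP; rewrite -subv0 -X1.
  exact: (sumv_sup ord0).
- by rewrite -Ysum; apply: eq_bigl => j; rewrite leq0n.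
- by apply: big1 => j; have := ltn_ord j; lia.
Qed.

(** [f] preserves the flag of [Y] and moves that of [X] up by at most one, so the image lies in
    [low X i.+2 :&: high Y i], which [low_high_step] splits into two neighbouring components. *)
Lemma split_dec_raise f (i : 'I_d.+1) : diag_action Y f -> tri_action X f ->
  (f @: split_dec i <= split_dec i + vat split_dec (i%:Z + 1))%VS.
Proof.
move=> fY fX; apply: (@subv_trans _ _ (low X i.+2 :&: high Y i)%VS).
  apply/subvP => _ /memv_imgP[v /memv_capP[vX vY] ->]; rewrite memv_cap.
  rewrite (subvP (tri_low fX _)) ?memv_img //=.
  by rewrite (subvP (diag_sum _ fY)) ?memv_img.
apply: subv_trans (low_high_step i) _; apply: addvS => //.
have [id|di] := ltnP i.+1 d.+1.
  by apply: (sumv_sup (Ordinal id)) => //=; lia.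
(* For i = d the second summand is 0, because [high Y d.+1] is an empty sum. *)
apply: subv_trans (capvSr _ _) _; rewrite /high big1 ?sub0v // => j ij.
by move: ij di (ltn_ord j); lia.
Qed.

(** Here the image lies in [low X i.+1 :&: high Y i.-1], to which [low_high_step] applies at index i
    - 1; for i = 0 the membership in [high Y 0], the whole space, is automatic. *)
Lemma split_dec_lower f (i : 'I_d.+1) : diag_action X f -> tri_action Y f ->
  (f @: split_dec i <= vat split_dec (i%:Z - 1) + split_dec i)%VS.
Proof.
move=> fX fY.
have fi v : v \in split_dec i -> f v \in low X i.+1.
  by case/memv_capP=> vX _; apply: (subvP (diag_sum _ fX)); apply: memv_img.
case: i fi => [[|i] id] fi; apply/subvP => _ /memv_imgP[v vi ->].
  apply: subvP (addvSr _ _) _ _; rewrite memv_cap fi //=.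
  suff -> : high Y 0 = fullv by rewrite memvf.
  by rewrite -Ysum; apply: eq_bigl => j; rewrite leq0n.
have : f v \in (low X i.+2 :&: high Y i)%VS.
  rewrite memv_cap fi //=; apply: (subvP (tri_high fY i)).
  by case/memv_capP: vi => _ vY; exact: memv_img.
move/(subvP (low_high_step i)); apply: subvP; apply: addvS => //.
by apply: (sumv_sup (Ordinal (ltnW id))) => //=; lia.
Qed.

End SplitDecomposition.

(** * Families in reversed order *)

Section Reversal.
Variables (F : fieldType) (V : vectType F) (d : nat) (X : 'I_d.+1 -> {vspace V}).

Definition rev_family (i : 'I_d.+1) : {vspace V} := X (rev_ord i).

Lemma tri_rev f : tri_action X f -> tri_action rev_family f.
Proof.
move=> fX i; apply: subv_trans (fX (rev_ord i)) _.
apply/subv_sumP => j /andP[ij ji]; apply: (sumv_sup (rev_ord j)).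
  by move: ij ji (ltn_ord i) (ltn_ord j) => /=; lia.
by rewrite /rev_family rev_ordK.
Qed.

Lemma sum_rev (p : pred 'I_d.+1) :
  (\sum_(i | p i) rev_family i)%VS = (\sum_(i | p (rev_ord i)) X i)%VS.
Proof.
rewrite (reindex_inj rev_ord_inj) /=.
by apply: eq_bigr => i _; rewrite /rev_family rev_ordK.
Qed.

End Reversal.

(** * Action on the module *)

(** By diagonalizability a subspace containing every [U i] is everything ([ext]). This is applied to
    the preimage of [U i] under [P i] and to the kernel of the sum of the idempotents minus the
    identity. *)
Lemma standard_idempotents (F : fieldType) (V : vectType F) (X : 'End(V)) d
    (U : 'I_d.+1 -> {vspace V}) (P : 'I_d.+1 -> 'End(V)) :
  diagonalizable_end X -> eigenspace_ordering X U -> primitive_idempotents U P ->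
  (forall i, limg (P i) = U i) /\ (\sum_i P i = \1)%VF.
Proof.
move=> [s sE] [_ Uall] UP.
have ext (W : {vspace V}) : (forall i, (U i <= W)%VS) -> W = fullv.
  move=> UW; apply/eqP; rewrite eqEsubv subvf -sE /= {sE}.
  elim: s => [|a s IHs]; first by rewrite big_nil sub0v.
  rewrite big_cons subv_add IHs andbT.
  have [->|a0] := eqVneq (leigenspace X a) 0%VS; first by rewrite sub0v.
  by have [|j ->] := (Uall (leigenspace X a)).2 _; first by exists a.
have PU i v : P i v \in U i.
  have /vspaceP/(_ v) : (P i @^-1: U i)%VS = fullv.
    apply: ext => j; apply/subvP => u uj; rewrite -memv_preim (UP _ _ _ uj).
    by case: eqP => [->//|_]; rewrite mem0v.
  by rewrite -memv_preim memvf.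
split=> [i|].
  apply: subv_anti; apply/andP; split; apply/subvP => v.
    by case/memv_imgP=> u _ ->.
  move=> vi; apply/memv_imgP; exists v; first exact: memvf.
  by rewrite (UP _ _ _ vi) eqxx.
apply/lfunP => v; have /vspaceP/(_ v) : lker (\sum_i P i - \1)%VF = fullv.
  apply: ext => j; apply/subvP => u uj; rewrite memv_ker add_lfunE opp_lfunE.
  rewrite sum_lfunE id_lfunE (bigD1 j) //= (UP _ _ _ uj) eqxx big1 ?addr0 ?subrr //.
  by move=> i /negPf ij; rewrite (UP _ _ _ uj) ij.
by rewrite memvf memv_ker add_lfunE opp_lfunE subr_eq0 => /eqP.
Qed.

Section GradedAction.
Variables (F : fieldType) (V : vectType F) (d : nat).
Variables (X Y : 'End(V)) (E : 'I_d.+1 -> 'End(V)) (th : 'I_d.+1 -> F).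
Hypothesis Eproj : forall i j v,
  v \in limg (E j) -> E i v = if i == j then v else 0.
Hypothesis Esum : (\sum_i E i = \1)%VF.
Hypothesis Eeig : forall i v, v \in limg (E i) -> X v = th i *: v.

Lemma idempotent_sum v : v = \sum_i E i v.
Proof. by rewrite -sum_lfunE Esum id_lfunE. Qed.

Lemma idempotent_eigen i v : E i (X v) = th i *: E i v.
Proof.
rewrite {1}(idempotent_sum v) !linear_sum (bigD1 i) //= big1 => [|j ji].
  rewrite addr0 (Eeig (memv_img _ (memvf _))) linearZ /=.
  by rewrite (Eproj _ (memv_img _ (memvf _))) eqxx.
rewrite (Eeig (memv_img _ (memvf _))) linearZ /=.
by rewrite (Eproj _ (memv_img _ (memvf _))) eq_sym (negPf ji) scaler0.
Qed.

(** For v in the i-th eigenspace, E_j (X (Y v)) is both th_j and th_i times E_j (Y v), so E_j (Y v)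
    = 0 for j different from i. *)
Lemma commuting_diag_action :
  injective th -> (forall v, X (Y v) = Y (X v)) ->
  diag_action (fun i => limg (E i)) Y.
Proof.
move=> th_inj XY i; apply/subvP => _ /memv_imgP[v vi ->].
rewrite (idempotent_sum (Y v)) memv_suml // => j _.
have [->|ji] := eqVneq j i; first exact: memv_img (memvf _).
suff -> : E j (Y v) = 0 by rewrite mem0v.
have := idempotent_eigen j (Y v); rewrite XY (Eeig vi).
rewrite !linearZ /= => /eqP; rewrite -subr_eq0 -scalerBl scaler_eq0 subr_eq0.
by rewrite (inj_eq th_inj) eq_sym (negPf ji) => /eqP.
Qed.

(** On v in the i-th eigenspace, E_j applied to the cubic relation gives E_j (Y v) times the product
    in the first hypothesis, nonzero unless i and j differ by at most one. *)
Lemma cubic_tri_action b :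
  (forall i j : 'I_d.+1, ~~ ((i <= j.+1)%N && (j <= i.+1)%N) ->
     (th j - th i) * (b^-1 * th j - th i) * (b * th j - th i) != 0) ->
  (let Z := b *: (X \o Y) - (Y \o X) in
   let T := b^-1 *: (X \o Z) - (Z \o X) in (X \o T) - (T \o X) = 0)%VF ->
  tri_action (fun i => limg (E i)) Y.
Proof.
move=> sep T0 i; apply/subvP => _ /memv_imgP[v vi ->].
rewrite (idempotent_sum (Y v)) memv_suml // => j _.
have [ij|ij] := boolP ((i <= j.+1)%N && (j <= i.+1)%N).
  by apply: (sum_memv (j := j)) => //; exact: memv_img (memvf _).
suff -> : E j (Y v) = 0 by rewrite mem0v.
have lE := (add_lfunE, opp_lfunE, scale_lfunE, comp_lfunE).
have EB u w : E j (u - w) = E j u - E j w by exact: linearB.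
have EZ a u : E j (a *: u) = a *: E j u by exact: linearZ.
have YZ a u : Y (a *: u) = a *: Y u by exact: linearZ.
have XZ a u : X (a *: u) = a *: X u by exact: linearZ.
have /lfunP/(_ v)/(congr1 (E j)) := T0.
rewrite /= !(lE, Eeig vi, YZ, XZ, EB, EZ, idempotent_eigen, lfunE) linear0 => /eqP.
rewrite (_ : _ - _ = ((th j - th i) * (b^-1 * th j - th i) * (b * th j - th i))
  *: E j (Y v)); first by rewrite scaler_eq0 (negPf (sep _ _ ij)) => /eqP.
by rewrite !(scalerBr, scalerA) -!scalerBl; congr (_ *: _); ring.
Qed.

End GradedAction.
(** Since th_i = c^i th_0, the factors compare c^i with c^j, c^{j-1} and c^{j+1}, and powers of c
    with distinct exponents are distinct. Replacing c = b by its inverse only exchanges the last two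
    factors. *)
Lemma geometric_separation (F : fieldType) (b c : F) d (th : 'I_d.+1 -> F) :
  b != 0 -> (forall n, (0 < n)%N -> c ^+ n != 1) -> c = b \/ c = b^-1 ->
  th ord0 != 0 -> (forall i j : 'I_d.+1, i = j.+1 :> nat -> th i = c * th j) ->
  forall i j : 'I_d.+1, ~~ ((i <= j.+1)%N && (j <= i.+1)%N) ->
    (th j - th i) * (b^-1 * th j - th i) * (b * th j - th i) != 0.
Proof.
move=> b0 c_ord cb t0 thS.
have c0 : c != 0 by case: cb => ->; rewrite ?invr_eq0.
have thE n (nd : (n < d.+1)%N) : th (Ordinal nd) = c ^+ n * th ord0.
  elim: n nd => [|n IHn] nd.
    by rewrite expr0 mul1r; congr th; exact: val_inj.
  by rewrite (thS _ (Ordinal (ltnW nd))) // IHn exprS mulrA.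
have lt_neq m n : (m < n)%N -> c ^+ m != c ^+ n.
  move=> mn; rewrite -(subnK (ltnW mn)) exprD -subr_eq0 -{1}[c ^+ m]mul1r.
  by rewrite -mulrBl mulf_neq0 ?expf_neq0 // subr_eq0 eq_sym c_ord // subn_gt0.
have pow_neq m n : m <> n -> c ^+ m * th ord0 - c ^+ n * th ord0 != 0.
  move=> mn; rewrite -mulrBl mulf_neq0 // subr_eq0.
  by have [/lt_neq|/lt_neq|//] := ltngtP m n; rewrite // eq_sym.
move=> [i id] [j jd] /= ij; rewrite (thE i id) (thE j jd).
have up : c * (c ^+ j * th ord0) - c ^+ i * th ord0 != 0.
  by rewrite mulrA -exprS pow_neq //; lia.
have down : c^-1 * (c ^+ j * th ord0) - c ^+ i * th ord0 != 0.
  rewrite -(inj_eq (mulfI c0)) mulr0 mulrBr !mulrA mulfV // mul1r -exprS.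
  by rewrite pow_neq //; lia.
rewrite -mulrA mulf_neq0 ?pow_neq //; first by lia.
by case: cb => cE; move: up down; rewrite cE ?invrK => up down; rewrite mulf_neq0.
Qed.

Lemma standard_tri (F : fieldType) (V : vectType F) (X Y : 'End(V)) d
    (U D : 'I_d.+1 -> {vspace V}) :
  (forall i, D i = U i) -> standard_ordering X Y U -> tri_action D Y.
Proof.
move=> DU [_ tri] i; rewrite DU; apply: subv_trans (tri i) _.
rewrite !subv_add -andbA; apply/and3P; split.
- by apply/subv_sumP => j /eqP ij; rewrite -DU; apply: (sumv_sup j) => //; lia.
- by rewrite -DU; apply: (sumv_sup i); rewrite //; lia.
- by apply/subv_sumP => j /eqP ij; rewrite -DU; apply: (sumv_sup j) => //; lia.
Qed.

Lemma tri_vat (F : fieldType) (V : vectType F) d (D : 'I_d.+1 -> {vspace V})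
    (f : 'End(V)) (i : 'I_d.+1) :
  tri_action D f ->
  (f @: D i <= vat D (i%:Z - 1) + D i + vat D (i%:Z + 1))%VS.
Proof.
move=> /(_ i)/subv_trans; apply; apply/subv_sumP => j /andP[ij ji].
have [lt_ij|lt_ji|/val_inj->] := ltngtP i j.
- apply: subv_trans (addvSr _ _); apply: (sumv_sup j) => //; lia.
- apply: subv_trans (addvSl _ _); apply: subv_trans (addvSl _ _).
  apply: (sumv_sup j) => //; lia.
- by apply: subv_trans (addvSl _ _); exact: addvSr.
Qed.

(** * The module action as an algebra homomorphism *)

Section Representation.
Variables (F : fieldType) (b : F) (V : vectType F) (rho : Uq b -> 'End(V)).
Hypothesis rhoP : Uq_module_action rho.

Lemma action_mul x y : rho (x * y) = (rho x \o rho y)%VF.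
Proof. by case: rhoP. Qed.

Lemma action0 : rho 0 = 0.
Proof.
case: rhoP => lin _ _; have := lin 1 0 0; rewrite !scale1r addr0.
by move/eqP; rewrite -subr_eq0 opprD addrA subrr sub0r oppr_eq0 => /eqP.
Qed.

Lemma action_scale a x : rho (a *: x) = a *: rho x.
Proof.
by case: rhoP => lin _ _; have := lin a x 0; rewrite action0 !addr0.
Qed.

Lemma action_sub x y : rho (x - y) = rho x - rho y.
Proof.
case: rhoP => lin _ _; have := lin 1 x (- y); rewrite !scale1r => ->.
by rewrite -scaleN1r action_scale scaleN1r.
Qed.

Lemma action_commute x y v : x * y = y * x -> rho x (rho y v) = rho y (rho x v).
Proof. by move=> xy; rewrite -!comp_lfunE -!action_mul xy. Qed.

Lemma action_cubic x y : comm x (qcomm b^-1 x (qcomm b x y)) = 0 ->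
  (let Z := b *: (rho x \o rho y) - (rho y \o rho x) in
   let T := b^-1 *: (rho x \o Z) - (Z \o rho x) in
   (rho x \o T) - (T \o rho x) = 0)%VF.
Proof.
by move/(congr1 rho); rewrite action0 /comm /qcomm
  !(action_sub, action_scale, action_mul).
Qed.

End Representation.

Lemma standard_component_neq0 (F : fieldType) (V : vectType F) (X : 'End(V)) d
    (U : 'I_d.+1 -> {vspace V}) i : eigenspace_ordering X U -> U i <> 0%VS.
Proof.
move=> [_ /(_ (U i))[+ _]] => /(_ (ex_intro _ i erefl))[a aX ->].
exact/eqP.
Qed.

Theorem theorem9p8 (F : fieldType) (V : vectType F)
    (Fbar : closedFieldType) (iota : {rmorphism F -> Fbar})
    (hFbar : forall x : Fbar, algebraicOver iota x)
    (q : Fbar) (hq0 : q <> 0)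
    (hq : forall n : nat, (0 < n)%N -> q ^+ n <> 1)
    (b : F) (hb : iota b = q ^+ 2)
    (hV : (fullv : {vspace V}) <> 0%VS)
    (d : nat) (hd : (1 <= d)%N)
    (A As : 'End(V)) (E Es : 'I_d.+1 -> 'End(V))
    (hTD : TD_system A E As Es)
    (hSerre : q_Serre_type b A E As Es)
    (rho : Uq b -> 'End(V))
    (hrho : Uq_module_action rho)
    (hrho0 : rho Uq_W0 = A) (hrho1 : rho Uq_W1 = As)
    (k : nat) (i : 'I_d.+1) :
  [/\
      let D := dec_0_D E in
      (rho (altW b (- k%:Z)) @: D i <= D i)%VS /\
      (rho (altW b (k%:Z + 1)) @: D i
         <= vat D (i%:Z - 1) + D i + vat D (i%:Z + 1))%VS,

      let D := dec_0s_Ds Es in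
      (rho (altW b (- k%:Z)) @: D i
         <= vat D (i%:Z - 1) + D i + vat D (i%:Z + 1))%VS /\
      (rho (altW b (k%:Z + 1)) @: D i <= D i)%VS
    &
      forall D : 'I_d.+1 -> {vspace V},
        [\/ D = dec_0s_0 E Es, D = dec_0s_D E Es,
            D = dec_Ds_0 E Es | D = dec_Ds_D E Es] ->
        (rho (altW b (- k%:Z)) @: D i <= D i + vat D (i%:Z + 1))%VS /\
        (rho (altW b (k%:Z + 1)) @: D i <= vat D (i%:Z - 1) + D i)%VS].
Proof.
have b0 : b != 0.
  apply/eqP => bE; move: hb; rewrite bE rmorph0 => /esym/eqP.
  by rewrite expf_eq0 /= => /eqP.
have b_ord n : (0 < n)%N -> b ^+ n != 1.
  (* b = q^2, so b^n = 1 would give q^{2n} = 1. *)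
  move=> n0; apply/eqP => bn; apply: (hq (2 * n)); first by rewrite muln_gt0.
  by rewrite exprM -hb -rmorphXn bn rmorph1.
have bV_ord n : (0 < n)%N -> b^-1 ^+ n != 1.
  by move=> n0; rewrite exprVn invr_eq1 b_ord.
have [[[dA dAs] _ _ irr] [U sU UE] [Us sUs UsE]] := hTD.
have [th [ths [thE thsE thS]]] := hSerre.
have [limE sumE] := standard_idempotents dA sU.1 UE.
have [limEs sumEs] := standard_idempotents dAs sUs.1 UsE.
have projE i' j v : v \in limg (E j) -> E i' v = if i' == j then v else 0.
  by rewrite limE => /UE.
have projEs i' j v : v \in limg (Es j) -> Es i' v = if i' == j then v else 0.
  by rewrite limEs => /UsE.
have eigen (X : 'End(V)) a (v : V) : v \in leigenspace X a -> X v = a *: v.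
  rewrite memv_ker add_lfunE opp_lfunE scale_lfunE id_lfunE subr_eq0.
  by move/eqP.
have eigE j v : v \in limg (E j) -> A v = th j *: v.
  by rewrite thE => /eigen.
have eigEs j v : v \in limg (Es j) -> As v = ths j *: v.
  by rewrite thsE => /eigen.
have th_inj : injective th.
  by move=> j l jl; apply: sU.1.1; rewrite -!limE !thE jl.
have ths_inj : injective ths.
  by move=> j l jl; apply: sUs.1.1; rewrite -!limEs !thsE jl.
(* A vanishing first eigenvalue would make the second one vanish too; d >= 1 provides two distinct
   eigenvalues. *)
have neq0 (c : F) (t : 'I_d.+1 -> F) : injective t ->
    (forall j l : 'I_d.+1, j = l.+1 :> nat -> t j = c * t l) -> t ord0 != 0.
  move=> t_inj tS; apply/eqP => t0.
  have /t_inj/(congr1 val) // : t (Ordinal (hd : (1 < d.+1)%N)) = t ord0.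
  by rewrite (tS _ ord0) // t0 mulr0.
have thS' (j l : 'I_d.+1) : j = l.+1 :> nat -> th j = b * th l by move=> /thS[].
have thsS' (j l : 'I_d.+1) : j = l.+1 :> nat -> ths j = b^-1 * ths l by move=> /thS[].
have sep := geometric_separation b0 b_ord (or_introl erefl)
  (neq0 _ _ th_inj thS') thS'.
have seps := geometric_separation b0 bV_ord (or_intror erefl)
  (neq0 _ _ ths_inj thsS') thsS'.
have -> : k%:Z + 1 = k.+1 by lia.
set wm := rho (altW b (- k%:Z)); set wp := rho (altW b k.+1).
have wmE : diag_action (fun j => limg (E j)) wm.
  apply: (commuting_diag_action projE sumE eigE th_inj) => v.
  by rewrite -hrho0 (action_commute hrho _ (alt_comm_W0 b0 b_ord k)).
have wpEs : diag_action (fun j => limg (Es j)) wp.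
  apply: (commuting_diag_action projEs sumEs eigEs ths_inj) => v.
  by rewrite -hrho1 (action_commute hrho _ (alt_comm_W1 b0 b_ord k)).
have wpE : tri_action (fun j => limg (E j)) wp.
  apply: (cubic_tri_action projE sumE eigE sep).
  by have := action_cubic hrho (alt_cubic_W0 b0 b_ord k); rewrite hrho0.
have wmEs : tri_action (fun j => limg (Es j)) wm.
  apply: (cubic_tri_action projEs sumEs eigEs seps).
  by have := action_cubic hrho (alt_cubic_W1 b0 b_ord k); rewrite hrho1.
have AEs := standard_tri limEs sUs; have AsE := standard_tri limE sU.
have fullE : (\sum_j limg (E j))%VS = fullv.
  apply/vspaceP => v; rewrite memvf (idempotent_sum sumE v) memv_sumr // => j _.
  exact: memv_img (memvf v).
have Es0 j : limg (Es j) <> 0%VS.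
  by rewrite limEs; exact: standard_component_neq0 sUs.1.
split; first by split; [exact: wmE | exact: tri_vat].
  by split; [exact: tri_vat | exact: wpEs].
(* Each of the four remaining decompositions is [split_dec X Y], with [X] the eigenspaces of [As]
   and [Y] those of [A]. An endpoint D* reverses [X] and an endpoint 0 reverses [Y]. *)
have split_actions (X Y : 'I_d.+1 -> {vspace V}) x y D :
    (forall j v, v \in X j -> As v = x j *: v) ->
    (forall j v, v \in Y j -> A v = y j *: v) ->
    tri_action X A -> tri_action Y As -> X ord0 <> 0%VS ->
    (\sum_j Y j)%VS = fullv ->
    diag_action Y wm -> tri_action X wm -> diag_action X wp -> tri_action Y wp ->
    D =1 split_dec X Y ->
    (wm @: D i <= D i + vat D (i%:Z + 1))%VS /\
    (wp @: D i <= vat D (i%:Z - 1) + D i)%VS.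
  move=> XE YE AX AsY X0 Yf mY mX pX pY DE.
  have vE l : vat D l = vat (split_dec X Y) l by apply: eq_bigr => j _.
  rewrite !vE DE; split.
    exact: (split_dec_raise irr XE YE AX AsY X0 Yf).
  exact: (split_dec_lower irr XE YE AX AsY X0 Yf).
have fullEr : (\sum_j rev_family (fun j => limg (E j)) j)%VS = fullv.
  by rewrite (sum_rev (fun j => limg (E j))).
have rev_le (j l : 'I_d.+1) : (l <= d - j)%N = (j <= rev_ord l)%N.
  by move: (ltn_ord j) (ltn_ord l) => /=; lia.
have rev_ge (j l : 'I_d.+1) : (d - j <= l)%N = (rev_ord l <= j)%N.
  by move: (ltn_ord j) (ltn_ord l) => /=; lia.
move=> D [] ->.
- apply: (split_actions _ _ ths (fun j => th (rev_ord j)) _ eigEs _ AEs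
    (tri_rev AsE) (Es0 _) fullEr _ wmEs wpEs (tri_rev wpE)).
  + by move=> j v; exact: eigE.
  + by move=> j; exact: wmE.
  + move=> j; congr (_ :&: _)%VS; rewrite /high sum_rev; apply: eq_bigl => l.
    exact: rev_le.
- exact: (split_actions _ _ ths th _ eigEs eigE AEs AsE (Es0 _) fullE wmE wmEs
    wpEs wpE).
- apply: (split_actions _ _ (fun j => ths (rev_ord j)) (fun j => th (rev_ord j))
    _ _ _ (tri_rev AEs) (tri_rev AsE) (Es0 _) fullEr _ (tri_rev wmEs) _
    (tri_rev wpE)).
  + by move=> j v; exact: eigEs.
  + by move=> j v; exact: eigE.
  + by move=> j; exact: wmE.
  + by move=> j; exact: wpEs.
  + move=> j; congr (_ :&: _)%VS; rewrite /low /high sum_rev.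
      by apply: eq_bigl => l; rewrite rev_ge.
    by apply: eq_bigl => l; rewrite rev_le.
- apply: (split_actions _ _ (fun j => ths (rev_ord j)) th
    _ _ eigE (tri_rev AEs) AsE (Es0 _) fullE wmE (tri_rev wmEs) _ wpE).
  + by move=> j v; exact: eigEs.
  + by move=> j; exact: wpEs.
  + move=> j; rewrite /split_dec /low sum_rev.
    by congr (_ :&: _)%VS; apply: eq_bigl => l; rewrite rev_ge.
Qed.
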